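(* Consider an instance generated by an IMLSBM in $\mathcal P_n(\rho,\{p_\ell\},\{q_\ell\},\beta)$ with $\rho\in(0,1/2)$, $\rho=o(1)$, $p_\ell\asymp q_\ell=o(1)$ for all $\ell$, $\beta=1+o(1)$ and $L\le n^c$ for a constant $c>0$. Suppose Init satisfies the consistent-initialization assumption. Fix $\ell\in[L]$ and suppose that for some constant $c'\in(0,1)$, $$\log L+Le^{-c'J_\rho}=o\Big(\min_{S\subseteq[L]\setminus\{\ell\}}\mathcal I_{S\cup\{\ell\}}\wedge\mathcal J_{\{\ell\}}\Big)\quad\text{and}\quad\min_{S\subseteq[L]\setminus\{\ell\}}\mathcal I_{S\cup\{\ell\}}\wedge\mathcal J_{\{\ell\}}\to\infty.$$ Then there is a sequence $\bar\delta_n=o(1)$ such that the individualized estimator $\hat{\mathbf z}^{(\ell)}$ output by Algorithm 3 satisfies $$\lim_{n\to\infty}\inf_{\mathbf z^\star\in\mathcal P_n}\mathbb P\Big(\mathcal L(\hat{\mathbf z}^{(\ell)},\mathbf z^{(\ell)})\le e^{-(1-\bar\delta_n)\min_{S\subseteq[L]\setminus\{\ell\}}\mathcal I_{S\cup\{\ell\}}}+e^{-(1-\bar\delta_n)\mathcal J_{\{\ell\}}}\Big)=1.$$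
   Context: Inhomogeneous multilayer SBM (IMLSBM). Fix integers $n,L\ge1$, a global label vector $\mathbf z^\star\in\{\pm1\}^n$, $\rho\in[0,1/2]$, and $0<q_\ell<p_\ell<1$ for $\ell\in[L]$. Individual label vectors $\mathbf z^{(\ell)}_i=\mathbf z^\star_i\xi_{\ell i}$ with $\xi_{\ell i}$ i.i.d., $P(\xi_{\ell i}=1)=1-\rho$, $P(\xi_{\ell i}=-1)=\rho$. Given the labels, the symmetric adjacency matrices $A^{(\ell)}\in\{0,1\}^{n\times n}$ have zero diagonal and independent entries $A^{(\ell)}_{ij}=A^{(\ell)}_{ji}$ ($i<j$), Bern$(p_\ell)$ if $\mathbf z^{(\ell)}_i=\mathbf z^{(\ell)}_j$ and Bern$(q_\ell)$ otherwise. $\mathcal P_n(\rho,\{p_\ell\},\{q_\ell\},\beta)$: such models with $n/(2\beta)\le\#\{i:\mathbf z^\star_i=\pm1\}\le n\beta/2$; an infimum ''over $\mathbf z^\star\in\mathcal P_n$'' ranges over all such $\mathbf z^\star$. Loss $\mathcal L(\hat{\mathbf z},\mathbf z)=n^{-1}\min\{d_H(\hat{\mathbf z},\mathbf z),d_H(-\hat{\mathbf z},\mathbf z)\}$. Probabilities are over labels and edges; asymptotics as $n\to\infty$; ''$p_\ell\asymp q_\ell=o(1)$'' means $q_\ell<p_\ell\le Cq_\ell$ for a constant $C$ independent of $n,\ell$ and $\max_\ell p_\ell\to0$. Information quantities: $I^{(\ell)}_t=-\log\big\{[p_\ell^{1-t}q_\ell^t+(1-p_\ell)^{1-t}(1-q_\ell)^t][p_\ell^tq_\ell^{1-t}+(1-p_\ell)^t(1-q_\ell)^{1-t}]\big\}$;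 $\psi_S(t)=-\frac n2\sum_{\ell\in S}I^{(\ell)}_t$; $\psi_S^\star(a)=\sup_{0\le t\le1}\{at-\psi_S(t)\}$; $J_\rho=-\log(2\sqrt{\rho(1-\rho)})$; $\mathcal I_S=|S^c|J_\rho+\psi^\star_S(0)$ if $|S^c|$ is even and $(|S^c|+1)J_\rho+\psi_S^\star(-2J_\rho)$ if $|S^c|$ is odd, $S^c=[L]\setminus S$; $\mathcal J_S=|S|J_\rho+\psi^\star_S(0)$ if $|S|$ is even and $(|S|+1)J_\rho+\psi^\star_S(-2J_\rho)$ if $|S|$ is odd. Algorithm 3 (inputs $\{A^{(\ell)}\}$, $\{p_\ell,q_\ell\}$, $\rho$, and a procedure Init). For $i\in[n]$, $\ell\in[L]$, $s_\star,s_\ell\in\{\pm1\}$ and a vector $\tilde{\mathbf z}$ indexed by $[n]\setminus\{i\}$, set $f^{(\ell)}_i(s_\star,s_\ell,\tilde{\mathbf z})=\log\frac{1-\rho}{\rho}\mathbf 1\{s_\ell=s_\star\}+\sum_{j\ne i:\tilde{\mathbf z}_j=s_\ell}\big[\log\frac{p_\ell(1-q_\ell)}{q_\ell(1-p_\ell)}A^{(\ell)}_{ij}+\log\frac{1-p_\ell}{1-q_\ell}\big]$. Stage I: for each $i$, run Init on the multilayer network $\{A^{(\ell)}_{-i,-i}\}$ obtained by deleting node $i$, obtaining $\tilde{\mathbf z}^{(-i)}\in\{\pm1\}^{[n]\setminus\{i\}}$. Stage II: for each $i$, compute $(\bar s^{\star}_i,\bar s^{1}_i,\dots,\bar s^{L}_i)\in\arg\max_{s_\star,s_1,\dots,s_L\in\{\pm1\}}\sum_\ell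 f^{(\ell)}_i(s_\star,s_\ell,\tilde{\mathbf z}^{(-i)})$; define $\bar{\mathbf z}^{\star,-i}\in\{\pm1\}^n$ by $\bar{\mathbf z}^{\star,-i}_j=\tilde{\mathbf z}^{(-i)}_j$ for $j\ne i$ and $\bar{\mathbf z}^{\star,-i}_i=\bar s^\star_i$, and $\bar{\mathbf z}^{\ell,-i}$ likewise with $\bar{\mathbf z}^{\ell,-i}_i=\bar s^\ell_i$. Stage III (alignment): $\hat{\mathbf z}^\star_1=\bar{\mathbf z}^{\star,-1}_1$, $\hat{\mathbf z}^{(\ell)}_1=\bar{\mathbf z}^{\ell,-1}_1$; for $i\ge2$, $\hat{\mathbf z}^\star_i\in\arg\max_{s\in\{\pm1\}}\#\big(\{j:\bar{\mathbf z}^{\star,-1}_j=s\}\cap\{j:\bar{\mathbf z}^{\star,-i}_j=\bar{\mathbf z}^{\star,-i}_i\}\big)$ and $\hat{\mathbf z}^{(\ell)}_i\in\arg\max_{s\in\{\pm1\}}\#\big(\{j:\bar{\mathbf z}^{\ell,-1}_j=s\}\cap\{j:\bar{\mathbf z}^{\ell,-i}_j=\bar{\mathbf z}^{\ell,-i}_i\}\big)$. Output $\hat{\mathbf z}^\star$ and $\hat{\mathbf z}^{(1)},\dots,\hat{\mathbf z}^{(L)}$ (ties broken arbitrarily). Consistent-initialization assumption: there exist $\delta_n=o(1)$ and constants $\varepsilon_{\mathrm{init}}>0$, $C'>0$ such that for every model in $\mathcal P_n$ and every $i\in[n]$, $\mathbb P\big(\min_{\pi\in\{\pm1\}}d_H(\pi\tilde{\mathbf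 z}^{(-i)},\mathbf z^\star_{-i})>n\delta_n\big)\le C'n^{-(1+\varepsilon_{\mathrm{init}})}$, where $\mathbf z^\star_{-i}$ is $\mathbf z^\star$ with coordinate $i$ removed. *)

(* Defs.v *)
From HB Require Import structures.
From mathcomp Require Import all_boot all_order all_algebra.
From mathcomp Require Import all_classical all_reals all_analysis.
Set Implicit Arguments. Unset Strict Implicit. Unset Printing Implicit Defensive.
Import Order.TTheory GRing.Theory Num.Theory.
Import numFieldNormedType.Exports.
Local Open Scope ring_scope.
Local Open Scope classical_set_scope.

(* Labels: bool, true = +1, false = -1.
   xi (k, i) = true  means xi_{k i} = -1 (a flip), which has probability rho. *)

Definition Itf (R : realType) (p q t : R) : R :=
  - ln ((p `^ (1 - t) * q `^ t + (1 - p) `^ (1 - t) * (1 - q) `^ t) *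
        (p `^ t * q `^ (1 - t) + (1 - p) `^ t * (1 - q) `^ (1 - t))).

Definition psiS (R : realType) (n L : nat) (p q : 'I_L -> R) (S : {set 'I_L})
  (t : R) : R :=
  - (n%:R / 2) * \sum_(k in S) Itf (p k) (q k) t.

Definition psiS_star (R : realType) (n L : nat) (p q : 'I_L -> R)
  (S : {set 'I_L}) (a : R) : R :=
  sup [set a * t - psiS n p q S t | t in [set t : R | 0 <= t <= 1]].

Definition Jrho (R : realType) (rho : R) : R :=
  - ln (2 * Num.sqrt (rho * (1 - rho))).

Definition calI (R : realType) (n L : nat) (rho : R) (p q : 'I_L -> R)
  (S : {set 'I_L}) : R :=
  let m := #|~: S| in
  if ~~ odd m then m%:R * Jrho rho + psiS_star n p q S 0
  else (m.+1)%:R * Jrho rho + psiS_star n p q S (- (2 * Jrho rho)).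

Definition calJ (R : realType) (n L : nat) (rho : R) (p q : 'I_L -> R)
  (S : {set 'I_L}) : R :=
  let m := #|S| in
  if ~~ odd m then m%:R * Jrho rho + psiS_star n p q S 0
  else (m.+1)%:R * Jrho rho + psiS_star n p q S (- (2 * Jrho rho)).

(* min_{S subset [L] \ {l}} I_{S u {l}}  (the S = empty term is used as seed) *)
Definition Imin (R : realType) (n L : nat) (rho : R) (p q : 'I_L -> R)
  (l : 'I_L) : R :=
  \big[Order.min/calI n rho p q [set l]]_(S : {set 'I_L} | l \notin S)
     calI n rho p q (S :|: [set l]).

Definition Mell (R : realType) (n L : nat) (rho : R) (p q : 'I_L -> R)
  (l : 'I_L) : R :=
  Order.min (Imin n rho p q l) (calJ n rho p q [set l]).

(* an outcome: the flips xi and the raw adjacency entries a (k, i, j) *)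
Definition Omega (n L : nat) : finType :=
  ({ffun 'I_L * 'I_n -> bool} * {ffun 'I_L * 'I_n * 'I_n -> bool})%type.

(* individual label z^{(k)}_i = z*_i xi_{k i} *)
Definition zind (n L : nat) (zs : 'I_n -> bool) (xi : {ffun 'I_L * 'I_n -> bool})
  (k : 'I_L) (i : 'I_n) : bool := addb (zs i) (xi (k, i)).

(* probability of an outcome: xi i.i.d.; given labels, independent Bernoulli
   entries for i < j, zero diagonal and symmetric (weight 0 otherwise) *)
Definition weight (R : realType) (n L : nat) (rho : R) (p q : 'I_L -> R)
  (zs : 'I_n -> bool) (w : Omega n L) : R :=
  let: (xi, a) := w in
  (\prod_(x : 'I_L * 'I_n) (if xi x then rho else 1 - rho)) *
  \prod_(t : 'I_L * 'I_n * 'I_n)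
    (let: (k, i, j) := t in
     if (val i < val j)%N then
       let pr := if zind zs xi k i == zind zs xi k j then p k else q k in
       (if a t then pr else 1 - pr)
     else if i == j then (if a t then 0 else 1)
     else (if a t == a (k, j, i) then 1 else 0)).

Definition Pr (R : realType) (n L : nat) (rho : R) (p q : 'I_L -> R)
  (zs : 'I_n -> bool) (E : Omega n L -> Prop) : R :=
  \sum_(w : Omega n L) weight rho p q zs w * (`[< E w >])%:R.

Definition balanced (R : realType) (n : nat) (beta : R) (zs : 'I_n -> bool) : Prop :=
  n%:R / (2 * beta) <= #|[set i | zs i]|%:R <= n%:R * beta / 2 /\
  n%:R / (2 * beta) <= #|[set i | ~~ zs i]|%:R <= n%:R * beta / 2.

Notation Vtx i := ({j | j != i}).

Definition InitT (n L : nat) :=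
  forall i : 'I_n, ('I_L -> Vtx i -> Vtx i -> bool) -> (Vtx i -> bool).

Definition delnet (n L : nat) (a : {ffun 'I_L * 'I_n * 'I_n -> bool}) (i : 'I_n) :
  'I_L -> Vtx i -> Vtx i -> bool :=
  fun k j j' => a (k, val j, val j').
Arguments delnet {n L} a i _ _ _.

Definition tz (n L : nat) (Init : InitT n L) (a : {ffun 'I_L * 'I_n * 'I_n -> bool})
  (i : 'I_n) : Vtx i -> bool := Init i (delnet a i).
Arguments tz {n L} Init a i _.

Definition fsc (R : realType) (n L : nat) (rho : R) (p q : 'I_L -> R)
  (a : {ffun 'I_L * 'I_n * 'I_n -> bool}) (i : 'I_n) (t : Vtx i -> bool)
  (k : 'I_L) (ss sl : bool) : R :=
  ln ((1 - rho) / rho) * (sl == ss)%:R +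
  \sum_(j : Vtx i | t j == sl)
     (ln (p k * (1 - q k) / (q k * (1 - p k))) * (a (k, i, val j))%:R
      + ln ((1 - p k) / (1 - q k))).
Arguments fsc {R n L} rho p q a i t k ss sl.

Definition score (R : realType) (n L : nat) (rho : R) (p q : 'I_L -> R)
  (a : {ffun 'I_L * 'I_n * 'I_n -> bool}) (i : 'I_n) (t : Vtx i -> bool)
  (ss : bool) (sv : {ffun 'I_L -> bool}) : R :=
  \sum_(k : 'I_L) fsc rho p q a i t k ss (sv k).
Arguments score {R n L} rho p q a i t ss sv.

Definition ext (n : nat) (i : 'I_n) (t : Vtx i -> bool) (b : bool) : 'I_n -> bool :=
  fun j => match (insub j : option (Vtx i)) with Some j' => t j' | None => b end.
Arguments ext {n} i t b _.

(* zhat is a possible output \hat z^{(l)} of Algorithm 3 on outcome a, for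
   SOME admissible tie-breaking in Stages II and III *)
Definition alg3_out (R : realType) (n L : nat) (rho : R) (p q : 'I_L -> R)
  (Init : InitT n L) (a : {ffun 'I_L * 'I_n * 'I_n -> bool}) (l : 'I_L)
  (zhat : 'I_n -> bool) : Prop :=
  exists sbar : 'I_n -> bool * {ffun 'I_L -> bool},
    (forall (i : 'I_n) ss sv, score rho p q a i (tz Init a i) ss sv <=
                      score rho p q a i (tz Init a i) (sbar i).1 (sbar i).2) /\
    (forall i : 'I_n, val i = 0%N -> zhat i = (sbar i).2 l) /\
    (forall i i0 : 'I_n, (0 < val i)%N -> val i0 = 0%N ->
       let bz := fun i' : 'I_n => ext i' (tz Init a i') ((sbar i').2 l) in
       forall s : bool,
         #|[set j | (bz i0 j == s) && (bz i j == bz i i)]| <=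
         #|[set j | (bz i0 j == zhat i) && (bz i j == bz i i)]|)%N.

Definition dH (n : nat) (z z' : 'I_n -> bool) : nat := #|[set i | z i != z' i]|.

Definition loss (R : realType) (n : nat) (zh z : 'I_n -> bool) : R :=
  (minn (dH zh z) (dH (fun i => ~~ zh i) z))%:R / n%:R.
Arguments loss {R n} zh z.

Definition dH_init (n : nat) (i : 'I_n) (t : Vtx i -> bool) (zs : 'I_n -> bool) : nat :=
  minn #|[set j : Vtx i | t j != zs (val j)]|
       #|[set j : Vtx i | ~~ t j != zs (val j)]|.

(* Main.v *)
(** Condition on everything away from a node i.  There the initialization is
    fixed and, up to a global sign, agrees with the labels of every layer on all
    but o(n) nodes (flips per layer concentrate uniformly since L <= n^c), while
    the row of i is a family of independent Bernoulli variables.  Chernoff's bound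
    with exponent t for a layer k costs exp((1 - o(1)) psi_k(t)): a misplaced node
    contributes a chi-square term, which is O(I_k(1/2)) because p <= C q.

    An error at layer l with the right global label, or when layer l itself is
    flipped, is local and has rate J_l.  Otherwise the global label is wrong, and
    the other layers are kept in a set S, flipped, or overruled by the global
    label; the last two kinds contribute +lambda and -lambda with
    lambda = log((1 - rho) / rho).  The best choice of t gives rate I_S, the parity
    of |S^c| appearing because the +-lambda must balance.

    The 3^L such partitions are summed without loss: layers with a half
    information above e0 J are at most I_min / (e0 J) many, and dropping h of the
    remaining ones costs at least h (1 - e0) J - J, so that h <= K contributes
    L^K and h > K contributes exp(2 L e^{-c' J}), both e^{o(M)}.
    Markov's inequality and the alignment of the gauges conclude. *)
Require Import Defs.
From HB Require Import structures.
From mathcomp Require Import all_boot all_order all_algebra.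
From mathcomp Require Import all_classical all_reals all_analysis.
From mathcomp Require Import ring lra zify.
Set Implicit Arguments. Unset Strict Implicit. Unset Printing Implicit Defensive.
Import Order.TTheory GRing.Theory Num.Theory.
Import numFieldNormedType.Exports.
Local Open Scope ring_scope.

(** * Moments of the likelihood ratio *)

(* likelihood-ratio moment: E (dBern p/dBern q)^t under Bern q *)
Definition lrm (R : realType) (p q t : R) : R :=
  q `^ (1 - t) * p `^ t + (1 - q) `^ (1 - t) * (1 - p) `^ t.

Section LikelihoodRatio.
Variable R : realType.
Implicit Types p q t : R.

(** Weighted arithmetic-geometric mean inequality, read off from Young's inequality with exponents
    1/(1-t) and 1/t; the endpoints, where one exponent is infinite, are treated apart. *)
Lemma powR_mean_le (x y t : R) : 0 < x -> 0 < y -> 0 <= t <= 1 ->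
  x `^ (1 - t) * y `^ t <= (1 - t) * x + t * y.
Proof.
move=> x0 y0 /andP[]; rewrite le_eqVlt => /predU1P[<-|t0].
  by rewrite subr0 (powRr1 (ltW x0)) powRr0 mulr1 mul1r mul0r addr0.
rewrite le_eqVlt => /predU1P[->|t1].
  by rewrite subrr (powRr1 (ltW y0)) powRr0 !mul1r mul0r add0r.
have s0 : 0 < 1 - t by rewrite subr_gt0.
have := @conjugate_powR R (x `^ (1 - t)) (y `^ t) (1 - t)^-1 t^-1
  (powR_ge0 _ _) (powR_ge0 _ _).
rewrite !invr_gt0 !invrK subrK => /(_ s0 t0 erefl).
rewrite -!powRrM !divff ?gt_eqF// (powRr1 (ltW x0)) (powRr1 (ltW y0)) => h.
by apply: (le_trans h); rewrite mulrC [y * t]mulrC.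
Qed.

Lemma lrm_gt0 p q t : 0 < p < 1 -> 0 < q < 1 -> 0 < lrm p q t.
Proof.
move=> /andP[p0 p1] /andP[q0 q1].
by apply: addr_gt0; apply: mulr_gt0; apply: powR_gt0; rewrite ?subr_gt0.
Qed.

Lemma lrm_le1 p q t : 0 < p < 1 -> 0 < q < 1 -> 0 <= t <= 1 -> lrm p q t <= 1.
Proof.
move=> /andP[p0 p1] /andP[q0 q1] t01.
have p0' : 0 < 1 - p by lra. have q0' : 0 < 1 - q by lra.
have h1 := powR_mean_le q0 p0 t01.
have h2 := powR_mean_le q0' p0' t01.
have -> : 1 = ((1 - t) * q + t * p) + ((1 - t) * (1 - q) + t * (1 - p)) by ring.
exact: lerD.
Qed.

Lemma ItfE p q t : Itf p q t = - ln (lrm p q (1 - t) * lrm p q t).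
Proof.
have e1 : lrm p q (1 - t) = p `^ (1 - t) * q `^ t + (1 - p) `^ (1 - t) * (1 - q) `^ t.
  by rewrite /lrm subKr (mulrC (q `^ t)) (mulrC ((1 - q) `^ t)).
have e2 : lrm p q t = p `^ t * q `^ (1 - t) + (1 - p) `^ t * (1 - q) `^ (1 - t).
  by rewrite /lrm (mulrC (q `^ (1 - t))) (mulrC ((1 - q) `^ (1 - t))).
by rewrite e1 e2.
Qed.

Lemma Itf_lnD p q t : 0 < p < 1 -> 0 < q < 1 ->
  Itf p q t = - (ln (lrm p q (1 - t)) + ln (lrm p q t)).
Proof. by move=> hp hq; rewrite ItfE lnM// posrE lrm_gt0. Qed.

Lemma ItfC p q t : Itf p q (1 - t) = Itf p q t.
Proof. by rewrite !ItfE subKr mulrC. Qed.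

Lemma ln_lrm_le0 p q t : 0 < p < 1 -> 0 < q < 1 -> 0 <= t <= 1 ->
  ln (lrm p q t) <= 0.
Proof. by move=> hp hq t01; rewrite ln_le0// lrm_le1. Qed.

Lemma onem01 t : 0 <= t <= 1 -> 0 <= 1 - t <= 1. Proof. by lra. Qed.

Lemma Itf_ge0 p q t : 0 < p < 1 -> 0 < q < 1 -> 0 <= t <= 1 -> 0 <= Itf p q t.
Proof.
move=> hp hq t01; rewrite Itf_lnD//.
have h1 := ln_lrm_le0 hp hq t01; have h2 := ln_lrm_le0 hp hq (onem01 t01).
by lra.
Qed.

(** Cauchy-Schwarz in two terms, with the roots [u] and [v] of the products given as data. *)
Lemma cauchy2 (a b c d u v : R) : 0 <= a -> 0 <= b -> 0 <= c -> 0 <= d ->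
  0 <= u -> 0 <= v -> a * c = u ^+ 2 -> b * d = v ^+ 2 ->
  (u + v) ^+ 2 <= (a + b) * (c + d).
Proof.
move=> a0 b0 c0 d0 u0 v0 ac bd.
suff h : 2 * (u * v) <= a * d + b * c.
  have -> : (a + b) * (c + d) = a * c + b * d + (a * d + b * c) by ring.
  by rewrite ac bd sqrrD; lra.
rewrite -ler_sqr ?nnegrE ?addr_ge0 ?mulr_ge0//.
have e : (a * d) * (b * c) = (u * v) ^+ 2.
  by rewrite exprMn -ac -bd; ring.
have -> : (2 * (u * v)) ^+ 2 = 4 * ((a * d) * (b * c)) by rewrite e; ring.
have := sqr_ge0 (a * d - b * c).
by rewrite !expr2; lra.
Qed.

(** Cauchy-Schwarz bounds the squared moment at 1/2 by the product of the moments at t and 1-t, so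
    the information is largest at t = 1/2. *)
Lemma Itf_le_half p q t : 0 < p < 1 -> 0 < q < 1 -> Itf p q t <= Itf p q 2^-1.
Proof.
move=> hp hq; rewrite !ItfE lerN2 ler_ln ?posrE ?mulr_gt0 ?lrm_gt0//.
have h2 : 1 - 2^-1 = 2^-1 :> R by lra.
have hh (x : R) : 0 < x -> x `^ (1 - t) * x `^ t = x.
  by move=> x0; rewrite -powRD ?subrK ?(powRr1 (ltW x0))// oner_eq0.
have hs (x : R) : 0 < x -> (x `^ 2^-1) ^+ 2 = x.
  by move=> x0; rewrite -powR_mulrn ?powR_ge0// -powRrM mulVf// (powRr1 (ltW x0)).
have [/andP[p0 p1] /andP[q0 q1]] := (hp, hq).
have p1' : 0 < 1 - p by lra. have q1' : 0 < 1 - q by lra.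
rewrite h2 -expr2 [lrm p q (1 - t)]/lrm subKr /lrm h2.
apply: cauchy2; rewrite ?mulr_ge0 ?powR_ge0//.
- have -> : q `^ t * p `^ (1 - t) * (q `^ (1 - t) * p `^ t) =
    (q `^ (1 - t) * q `^ t) * (p `^ (1 - t) * p `^ t) by ring.
  by rewrite !hh// exprMn !hs.
- have -> : (1 - q) `^ t * (1 - p) `^ (1 - t) * ((1 - q) `^ (1 - t) * (1 - p) `^ t) =
    ((1 - q) `^ (1 - t) * (1 - q) `^ t) * ((1 - p) `^ (1 - t) * (1 - p) `^ t) by ring.
  by rewrite !hh// exprMn !hs.
Qed.

End LikelihoodRatio.

(** * Moment generating function of one edge *)

Definition llr (R : realType) (p q : R) (b : bool) : R :=
  if b then ln (p / q) else ln ((1 - p) / (1 - q)).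

(** Moment at [t] of the signed log-likelihood ratio of one edge: [same] selects its true parameter,
    and [differ] is the sign given to it by the estimated label of the other endpoint. That endpoint
    is placed correctly when [differ] is the negation of [same]. *)
Definition edge_mgf (R : realType) (p q t : R) (differ same : bool) : R :=
  let pr := if same then p else q in
  let sg := if differ then 1 else -1 in
  pr * expR (t * (sg * llr p q true)) + (1 - pr) * expR (t * (sg * llr p q false)).

Section EdgeMgf.
Variable R : realType.
Implicit Types p q t : R.

Lemma llrE p q (b : bool) : 0 < p < 1 -> 0 < q < 1 ->
  ln (p * (1 - q) / (q * (1 - p))) * b%:R + ln ((1 - p) / (1 - q)) = llr p q b.
Proof.
move=> /andP[p0 p1] /andP[q0 q1]; case: b => /=; last by rewrite mulr0 add0r.
have p1' : 0 < 1 - p by lra. have q1' : 0 < 1 - q by lra.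
rewrite mulr1 -lnM ?posrE ?divr_gt0 ?mulr_gt0//; congr ln; field.
by rewrite !gt_eqF.
Qed.

Lemma expR_mulln (x t : R) : 0 < x -> expR (t * ln x) = x `^ t.
Proof. by move=> x0; rewrite /powR gt_eqF. Qed.

Lemma mul_ratio_powR (x y t : R) : 0 < x -> 0 < y ->
  x * expR (t * (1 * ln (y / x))) = x `^ (1 - t) * y `^ t.
Proof.
move=> x0 y0; rewrite mul1r expR_mulln ?divr_gt0//.
have -> : x `^ (1 - t) = x * x `^ (- t).
  have xn0 : (1 - t == 0) ==> (x != 0) by rewrite (gt_eqF x0) implybT.
  by rewrite (powRD xn0) (powRr1 (ltW x0)).
rewrite powRM ?invr_ge0 ?(ltW x0) ?(ltW y0)//.
rewrite -(powR_inv1 (ltW x0)) -powRrM mulN1r; ring.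
Qed.

Lemma ln_invr_ratio (x y : R) : 0 < x -> 0 < y -> - ln (x / y) = ln (y / x).
Proof. by move=> x0 y0; rewrite -lnV ?posrE ?divr_gt0// invf_div. Qed.

Lemma edge_mgf_lrm p q t b : 0 < p < 1 -> 0 < q < 1 ->
  edge_mgf p q t b (~~ b) = if b then lrm p q t else lrm p q (1 - t).
Proof.
move=> /andP[p0 p1] /andP[q0 q1].
have p1' : 0 < 1 - p by lra. have q1' : 0 < 1 - q by lra.
rewrite /edge_mgf /llr /lrm; case: b => /=; first by rewrite !mul_ratio_powR.
rewrite !mulN1r !ln_invr_ratio// subKr.
rewrite -[ln (q / p)]mul1r -[ln ((1 - q) / (1 - p))]mul1r !mul_ratio_powR//.
by rewrite mulrC [(1 - p) `^ _ * _]mulrC.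
Qed.

Lemma mul_ratio_le (x y t : R) : 0 < x -> 0 < y -> 0 <= t <= 1 ->
  x * expR (t * ln (x / y)) <= (1 - t) * x + t * (x ^+ 2 / y).
Proof.
move=> x0 y0 t01; rewrite expR_mulln ?divr_gt0//.
have := powR_mean_le (@ltr01 R) (divr_gt0 x0 y0) t01.
rewrite powR1 mul1r mulr1 => /(ler_wpM2l (ltW x0)) /le_trans; apply.
by rewrite le_eqVlt; apply/orP; left; apply/eqP; ring.
Qed.

(** Each power is bounded by its chord in t, and the chords sum to 1 plus t times the chi-square
    divergence of Bern(x) from Bern(y). *)
Lemma wrong_mgf_le (x y t : R) : 0 < x < 1 -> 0 < y < 1 -> 0 <= t <= 1 ->
  x * expR (t * ln (x / y)) + (1 - x) * expR (t * ln ((1 - x) / (1 - y))) <=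
  1 + (x - y) ^+ 2 / (y * (1 - y)).
Proof.
move=> /andP[x0 x1] /andP[y0 y1] t01.
have x1' : 0 < 1 - x by lra. have y1' : 0 < 1 - y by lra.
apply: (le_trans (lerD (mul_ratio_le x0 y0 t01) (mul_ratio_le x1' y1' t01))).
have -> : (1 - t) * x + t * (x ^+ 2 / y) + ((1 - t) * (1 - x) +
    t * ((1 - x) ^+ 2 / (1 - y))) = 1 + t * ((x - y) ^+ 2 / (y * (1 - y))).
  by field; rewrite !gt_eqF.
rewrite lerD2l ler_piMl//; last by case/andP: t01.
by rewrite divr_ge0 ?sqr_ge0// ltW// mulr_gt0.
Qed.

(** Factor p - q as a difference of squares of roots. The squared difference of the roots is at most
    the information at 1/2, by ln x <= x - 1 applied to the affinity; the squared sum is at most 2(p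
    + q) <= 4Cq. *)
Lemma Itf_half_ge p q C : 0 < q -> q < p -> p < 1 -> p <= C * q ->
  (p - q) ^+ 2 / q <= 4 * C * Itf p q 2^-1.
Proof.
move=> q0 qp p1 pC.
have p0 : 0 < p by lra. have q1 : q < 1 by lra.
have p1' : 0 < 1 - p by lra. have q1' : 0 < 1 - q by lra.
have hs (x : R) : 0 < x -> (x `^ 2^-1) ^+ 2 = x.
  by move=> x0; rewrite -powR_mulrn ?powR_ge0// -powRrM mulVf// (powRr1 (ltW x0)).
have h2 : 1 - 2^-1 = 2^-1 :> R by lra.
have C0 : 0 < C by rewrite -(pmulr_lgt0 _ q0); lra.
have hp : 0 < p < 1 by lra. have hq : 0 < q < 1 by lra.
set a := p `^ 2^-1; set b := q `^ 2^-1.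
set c := (1 - p) `^ 2^-1; set d := (1 - q) `^ 2^-1.
have [a2 b2] : a ^+ 2 = p /\ b ^+ 2 = q by rewrite !hs.
have [c2 d2] : c ^+ 2 = 1 - p /\ d ^+ 2 = 1 - q by rewrite !hs.
have a0 : 0 < a by rewrite powR_gt0. have b0 : 0 < b by rewrite powR_gt0.
have I_ge : (a - b) ^+ 2 <= Itf p q 2^-1.
  have lg := lrm_gt0 2^-1 hp hq.
  rewrite Itf_lnD// h2.
  have : ln (lrm p q 2^-1) <= lrm p q 2^-1 - 1.
    have := @le_ln1Dx R (lrm p q 2^-1 - 1).
    by rewrite addrCA subrr addr0; apply; lra.
  have -> : lrm p q 2^-1 = b * a + d * c by rewrite /lrm h2.
  have := sqr_ge0 (c - d); rewrite !sqrrB a2 b2 c2 d2.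
  by rewrite ![_ *+ 2]mulr2n [b * a]mulrC [d * c]mulrC; lra.
have e : (p - q) ^+ 2 = (a - b) ^+ 2 * (a + b) ^+ 2.
  by rewrite -a2 -b2; ring.
have h4 : (a + b) ^+ 2 <= 4 * C * q.
  have := sqr_ge0 (a - b); rewrite sqrrB sqrrD a2 b2.
  by rewrite ![_ *+ 2]mulr2n; lra.
rewrite ler_pdivrMr// e.
have -> : 4 * C * Itf p q 2^-1 * q = Itf p q 2^-1 * (4 * C * q) by ring.
by apply: ler_pM; rewrite ?sqr_ge0.
Qed.

(** Equal flags mean a misplaced endpoint. As p <= 1/2, the chi-square term is at most 2(p-q)^2/q,
    hence at most 8C times the information at 1/2. *)
Lemma edge_mgf_wrong p q C t b : 0 < q -> q < p -> p <= 2^-1 -> p <= C * q ->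
  0 <= t <= 1 ->
  edge_mgf p q t b b <= expR (8 * C * Itf p q 2^-1).
Proof.
move=> q0 qp p2 pC t01.
have p1 : p < 1 by lra. have q1 : q < 1 by lra. have p0 : 0 < p by lra.
have p1' : 0 < 1 - p by lra. have q1' : 0 < 1 - q by lra.
have hp : 0 < p < 1 by lra. have hq : 0 < q < 1 by lra.
suff : edge_mgf p q t b b <= 1 + 2 * ((p - q) ^+ 2 / q).
  move/le_trans; apply; apply: (le_trans _ (expR_ge1Dx _)).
  by have := Itf_half_ge q0 qp p1 pC; lra.
have key (y : R) : q <= y -> y <= 2^-1 ->
    (p - q) ^+ 2 / (y * (1 - y)) <= 2 * ((p - q) ^+ 2 / q).
  move=> qy y2; have y0 : 0 < y by lra.
  rewrite mulrCA ler_wpM2l ?sqr_ge0// -[2 / q]invf_div.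
  rewrite lef_pV2 ?posrE ?divr_gt0 ?mulr_gt0 ?subr_gt0//; last by lra.
  have : 0 <= y * (1 - y - 2^-1) by apply: mulr_ge0; lra.
  by lra.
rewrite /edge_mgf /llr; case: b => /=.
  rewrite !mul1r; apply: (le_trans (wrong_mgf_le hp hq t01)).
  by rewrite lerD2l; apply: key; lra.
rewrite !mulN1r !ln_invr_ratio//; apply: (le_trans (wrong_mgf_le hq hp t01)).
by rewrite lerD2l -sqrrN opprB; apply: key; lra.
Qed.

End EdgeMgf.

(** * Products of Bernoulli measures *)

Definition bern (R : realType) (m : R) (b : bool) : R := if b then m else 1 - m.

Definition bern_expect (R : realType) (T : finType) (mu : T -> R)
  (F : {ffun T -> bool} -> R) : R :=
  \sum_(f : {ffun T -> bool}) (\prod_x bern (mu x) (f x)) * F f.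

Definition splice (T : finType) (D : pred T) (f g : {ffun T -> bool}) :
  {ffun T -> bool} := [ffun x => if D x then g x else f x].

Section BernoulliProduct.
Variables (R : realType) (T : finType) (mu : T -> R).
Hypothesis mu01 : forall x, 0 <= mu x <= 1.
Local Notation "'E F" := (bern_expect mu F) (at level 10, F at level 8).
Implicit Types F : {ffun T -> bool} -> R.

Lemma sum_bern (m : R) : \sum_b bern m b = 1.
Proof. by rewrite big_bool /= addrC subrK. Qed.

Lemma bern_weight_ge0 (f : {ffun T -> bool}) : 0 <= \prod_x bern (mu x) (f x).
Proof.
apply: prodr_ge0 => x _; have /andP[h0 h1] := mu01 x.
by rewrite /bern; case: (f x); rewrite ?subr_ge0.
Qed.

Lemma bern_expect_prod (phi : T -> bool -> R) :
  'E (fun f => \prod_x phi x (f x)) = \prod_x \sum_b bern (mu x) b * phi x b.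
Proof.
rewrite bigA_distr_bigA /bern_expect; apply: eq_bigr => f _.
by rewrite -big_split.
Qed.

Lemma bern_expect_cst c : 'E (fun _ => c) = c.
Proof.
rewrite /bern_expect -mulr_suml; have -> : \sum_(f : {ffun T -> bool}) \prod_x bern (mu x) (f x) = 1.
  by rewrite -(bigA_distr_bigA (fun x b => bern (mu x) b)) big1// => x _; exact: sum_bern.
by rewrite mul1r.
Qed.

Lemma eq_bern_expect F G : F =1 G -> 'E F = 'E G.
Proof. by move=> FG; apply: eq_bigr => f _; rewrite FG. Qed.

Lemma le_bern_expect F G : (forall f, F f <= G f) -> 'E F <= 'E G.
Proof.
by move=> FG; apply: ler_sum => f _; rewrite ler_wpM2l ?bern_weight_ge0.
Qed.

Lemma bern_expect_sum (I : finType) (P : pred I) (G : I -> {ffun T -> bool} -> R) :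
  'E (fun f => \sum_(i | P i) G i f) = \sum_(i | P i) 'E (G i).
Proof.
rewrite /bern_expect exchange_big; apply: eq_bigr => f _ /=.
by rewrite mulr_sumr.
Qed.

Lemma bern_expectD F G : 'E (fun f => F f + G f) = 'E F + 'E G.
Proof.
by rewrite /bern_expect -big_split; apply: eq_bigr => f _; rewrite /= mulrDr.
Qed.

Lemma bern_expectZ c F : 'E (fun f => c * F f) = c * 'E F.
Proof.
by rewrite /bern_expect mulr_sumr; apply: eq_bigr => f _; rewrite mulrCA.
Qed.

(* swapping the coordinates in D between two independent copies preserves
   the product measure *)
Lemma bern_expect_resample (D : pred T) F :
  'E F = 'E (fun f => 'E (fun g => F (splice D f g))).
Proof.
pose sw (u : {ffun T -> bool} * {ffun T -> bool}) := (splice D u.1 u.2, splice D u.2 u.1).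
have swK : involutive sw.
  by case=> f g; congr pair; apply/ffunP => x; rewrite !ffunE /=; case: (D x).
pose w (u : {ffun T -> bool} * {ffun T -> bool}) :=
  (\prod_x bern (mu x) (u.1 x)) * \prod_x bern (mu x) (u.2 x).
have wsw u : w (sw u) = w u.
  rewrite /w -!big_split; apply: eq_bigr => x _ /=; rewrite !ffunE.
  by case: (D x) => //; rewrite mulrC.
transitivity (\sum_u w u * F u.1).
  rewrite -(pair_bigA _ (fun f g => w (f, g) * F f)).
  apply: eq_bigr => f _ /=; rewrite -[LHS]mulr1 -[X in _ * X = _](bern_expect_cst 1).
  by rewrite mulr_sumr; apply: eq_bigr => g _; rewrite /w /= mulr1 mulrAC.
rewrite (reindex_inj (inv_inj swK)) /=.
under eq_bigr do rewrite wsw.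
rewrite -(pair_bigA _ (fun f g => w (f, g) * F (splice D f g))).
apply: eq_bigr => f _ /=; rewrite mulr_sumr; apply: eq_bigr => g _.
by rewrite /w mulrA.
Qed.

(** Independence of distinct coordinates: factors are regrouped by the coordinate they read, at most
    one for each by injectivity, and a coordinate read by none integrates to 1. *)
Lemma bern_expect_inj_prod (J : finType) (iota : J -> T) (phi : J -> bool -> R) :
  injective iota ->
  'E (fun f => \prod_j phi j (f (iota j))) =
  \prod_j \sum_b bern (mu (iota j)) b * phi j b.
Proof.
move=> inj; pose psi x b := \prod_(j | iota j == x) phi j b.
transitivity ('E (fun f => \prod_x psi x (f x))).
  apply: eq_bern_expect => f; rewrite (partition_big iota predT)//=.
  by apply: eq_bigr => x _; apply: eq_bigr => j /eqP ->.
rewrite bern_expect_prod [RHS](partition_big iota predT)//=.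
apply: eq_bigr => x _; rewrite /psi.
have [[j jx]|nj] := pselect (exists j, iota j = x).
  have e : (fun j' => iota j' == x) =1 pred1 j.
    by move=> j'; rewrite -jx (inj_eq inj).
  rewrite [RHS](eq_bigl _ _ e) big_pred1_eq jx; apply: eq_bigr => b _.
  by rewrite (eq_bigl _ _ e) big_pred1_eq.
have e : (fun j' => iota j' == x) =1 pred0.
  by move=> j'; apply/negP => /eqP h; apply: nj; exists j'.
rewrite [RHS](eq_bigl _ _ e) big_pred0_eq; apply: etrans (sum_bern (mu x)).
by apply: eq_bigr => b _; rewrite (eq_bigl _ _ e) big_pred0_eq mulr1.
Qed.

End BernoulliProduct.

(** * The model as a product of Bernoulli variables *)

(* Independent coordinates realizing the model: the flips, and for every layer
   and pair i < j two coins, the one used when the labels of i and j agree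
   (flag true) and the one used when they differ. *)
Definition model_coord (n L : nat) : finType :=
  ('I_L * 'I_n + 'I_L * 'I_n * 'I_n * bool)%type.

Definition coord_mean (R : realType) (n L : nat) (rho : R) (p q : 'I_L -> R)
  (c : model_coord n L) : R :=
  match c with
  | inl _ => rho
  | inr (k, _, _, b) => if b then p k else q k
  end.

Definition flips (n L : nat) (w : {ffun model_coord n L -> bool}) :
  {ffun 'I_L * 'I_n -> bool} := [ffun x => w (inl x)].

(** The pair is ordered so that both entries of the symmetric matrix read the same coin. The
    diagonal falls into the second branch and is masked in [adjacency]. *)
Definition edge_coord (n L : nat) (k : 'I_L) (i j : 'I_n) (same : bool) : model_coord n L :=
  if (i < j)%N then inr (k, i, j, same) else inr (k, j, i, same).

Definition adjacency (n L : nat) (zs : 'I_n -> bool) (w : {ffun model_coord n L -> bool}) :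
  {ffun 'I_L * 'I_n * 'I_n -> bool} :=
  [ffun t => let: (k, i, j) := t in
    (i != j) &&
    w (edge_coord k i j (zind zs (flips w) k i == zind zs (flips w) k j))].

Definition outcome (n L : nat) (zs : 'I_n -> bool) (w : {ffun model_coord n L -> bool}) :
  Omega n L := (flips w, adjacency zs w).

Section Outcome.
Variables (R : realType) (n L : nat) (rho : R) (p q : 'I_L -> R).
Variable zs : 'I_n -> bool.

Definition valid_adj (a : {ffun 'I_L * 'I_n * 'I_n -> bool}) : bool :=
  [forall k, forall i, forall j, (a (k, i, j) == a (k, j, i)) && ~~ a (k, i, i)].

Lemma valid_adjP (a : {ffun 'I_L * 'I_n * 'I_n -> bool}) : reflect
  (forall k i j, a (k, i, j) = a (k, j, i) /\ a (k, i, i) = false) (valid_adj a).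
Proof.
apply: (iffP forallP) => [h k i j|h k].
  by move/forallP: (h k) => /(_ i)/forallP/(_ j)/andP[/eqP -> /negbTE ->].
by apply/forallP => i; apply/forallP => j; have [-> ->] := h k i j; rewrite eqxx.
Qed.

Lemma edge_coordC k (i j : 'I_n) b : i != j ->
  edge_coord k i j b = edge_coord k j i b :> model_coord n L.
Proof. by rewrite /edge_coord neq_ltn; case: ltngtP. Qed.

Lemma adjacency_valid w : valid_adj (adjacency zs w).
Proof.
apply/valid_adjP => k i j; rewrite !ffunE eqxx; split=> //.
rewrite eq_sym; case: eqVneq => //= ij.
by rewrite edge_coordC 1?eq_sym// [zind _ _ _ i == _]eq_sym.
Qed.

(** Constraint put on each coordinate by the outcome [o]: flips are forced, and for each i < j only
    the coin selected by the labels is; all other coins are free. The preimage of [o] is thus a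
    product set. *)
Definition fiber (o : Omega n L) (c : model_coord n L) : pred bool :=
  match c with
  | inl x => pred1 (o.1 x)
  | inr (k, i, j, b) =>
      if (i < j)%N && (b == (zind zs o.1 k i == zind zs o.1 k j))
      then pred1 (o.2 (k, i, j)) else predT
  end.

Lemma outcome_fiber (o : Omega n L) w : valid_adj o.2 ->
  (outcome zs w == o) = (w \in family (fiber o)).
Proof.
case: o => xi a /= /valid_adjP va; apply/eqP/familyP => [[<- <-] [x|[[[k i] j] b]]|h].
- by rewrite inE ffunE.
- rewrite unfold_in /=; case: ifP => // /andP[ij /eqP ->] /=.
  by rewrite ffunE -(inj_eq val_inj) neq_ltn ij /= /edge_coord ij.
have ex : flips w = xi by apply/ffunP => x; rewrite ffunE; apply/eqP/(h (inl x)).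
rewrite /outcome ex; congr pair; apply/ffunP => -[[k i] j]; rewrite ffunE ex.
have hlt (i1 j1 : 'I_n) : (i1 < j1)%N ->
    w (edge_coord k i1 j1 (zind zs xi k i1 == zind zs xi k j1)) = a (k, i1, j1).
  move=> ij; rewrite /edge_coord ij; apply/eqP.
  by have := h (inr (k, i1, j1, (zind zs xi k i1 == zind zs xi k j1)));
    rewrite unfold_in /= ij eqxx.
have [ij|ij|/val_inj ->] := ltngtP i j.
- by rewrite hlt// neq_ltn ij.
- by rewrite edge_coordC ?neq_ltn ?ij ?orbT// eq_sym hlt//; case: (va k i j).
- by rewrite eqxx; case: (va k j j).
Qed.

(** Over a product set the sum factors, and free coins sum to 1. For an adjacency that is not
    symmetric with zero diagonal both sides vanish. *)
Lemma weight_fiber (o : Omega n L) :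
  \sum_(w | outcome zs w == o) \prod_c bern (coord_mean rho p q c) (w c) =
  weight rho p q zs o.
Proof.
have [vo|nvo] := boolP (valid_adj o.2).
  rewrite (eq_bigl _ _ (fun w => outcome_fiber w vo)).
  rewrite -(bigA_distr_big_dep (fiber o) (fun c b => bern (coord_mean rho p q c) b)).
  rewrite big_sumType /=; case: o vo => xi a /= /valid_adjP va; congr (_ * _).
    apply: eq_bigr => x _; rewrite (eq_bigl (pred1 (xi x)))//.
    by rewrite big_pred1_eq; case: (xi x).
  transitivity (\prod_(t : 'I_L * 'I_n * 'I_n) \prod_(b : bool)
    \sum_(b' | fiber (xi, a) (inr (t, b)) b')
    bern (coord_mean rho p q (inr (t, b))) b').
    by rewrite [RHS]pair_bigA; apply: eq_bigr => -[[[k i] j] b] _.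
  apply: eq_bigr => -[[k i] j] _ /=.
  have [ij|ij|/val_inj ->] := ltngtP i j.
  - rewrite big_bool /=; case: (zind _ _ _ _ == _) => /=;
      by rewrite big_pred1_eq sum_bern ?mulr1 ?mul1r; case: (a _).
  - have ne : i == j = false by rewrite -val_eqE /= gtn_eqF.
    by rewrite ne big_bool /= !sum_bern mulr1; case: (va k i j) => ->; rewrite eqxx.
  - by rewrite !eqxx big_bool /= !sum_bern mulr1; case: (va k j j) => _ ->.
rewrite big1 => [|w /eqP wo]; last by rewrite -wo adjacency_valid in nvo.
case: o nvo => xi a /=; rewrite /weight => nva.
suff [t ht] : exists t : 'I_L * 'I_n * 'I_n, (let: (k, i, j) := t in
     if (val i < val j)%N then
       let pr := if zind zs xi k i == zind zs xi k j then p k else q k in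
       (if a t then pr else 1 - pr)
     else if i == j then (if a t then 0 else 1)
     else (if a t == a (k, j, i) then 1 else 0)) = 0 :> R.
  by rewrite [X in _ * X](bigD1 t)//= ht mul0r mulr0.
move: nva; rewrite negb_forall => /existsP[k]; rewrite negb_forall => /existsP[i].
rewrite negb_forall => /existsP[j]; rewrite negb_and negbK => /orP[aij|aii]; last first.
  by exists (k, i, i); rewrite ltnn eqxx aii.
have [ij|ij|/val_inj e] := ltngtP i j; last by rewrite e eqxx in aij.
- exists (k, j, i); rewrite ltnNge (ltnW ij) /= -val_eqE /= gtn_eqF//.
  by rewrite eq_sym (negbTE aij).
- exists (k, i, j); rewrite ltnNge (ltnW ij) /= -val_eqE /= gtn_eqF//.
  by rewrite (negbTE aij).
Qed.

Lemma Pr_expect (E : Omega n L -> Prop) :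
  Pr rho p q zs E =
  bern_expect (coord_mean rho p q) (fun w => (`[< E (outcome zs w) >])%:R).
Proof.
rewrite /bern_expect (partition_big (outcome zs) predT)//=.
apply: eq_bigr => o _; rewrite -weight_fiber mulr_suml.
by apply: eq_bigr => w /eqP ->.
Qed.

End Outcome.

(** * Rate functions *)

Lemma expr_mul_split (R : comNzRingType) (x y : R) (a b : nat) : (a <= b)%N ->
  x ^+ b * y ^+ a = (x * y) ^+ a * x ^+ (b - a).
Proof. by move=> ab; rewrite -{1}(subnKC ab) exprD exprMn; ring. Qed.

Section Rates.
Variables (R : realType) (n L : nat) (rho : R) (p q : 'I_L -> R).
Hypothesis rho_bd : 0 < rho < 1 / 2.
Hypothesis p01 : forall k, 0 < p k < 1.
Hypothesis q01 : forall k, 0 < q k < 1.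
Implicit Types (S : {set 'I_L}) (t a : R).

Local Notation J := (Jrho rho).
Local Notation psi := (psiS n p q).
Local Notation psi_star := (psiS_star n p q).

Lemma rho_bds : 0 < rho /\ rho < 2^-1.
Proof. by case/andP: rho_bd => r0 r2; split=> //; rewrite -[2^-1]mul1r. Qed.

Definition half_info (k : 'I_L) : R := n%:R / 2 * Itf (p k) (q k) 2^-1.
Local Notation dsum S := (\sum_(k in S) half_info k).

Lemma half_info_ge0 k : 0 <= half_info k.
Proof. by rewrite mulr_ge0 ?divr_ge0// Itf_ge0//; lra. Qed.

Lemma psiSE S t : psi S t = - \sum_(k in S) n%:R / 2 * Itf (p k) (q k) t.
Proof. by rewrite /psiS mulNr mulr_sumr. Qed.

Lemma psiSC S t : psi S (1 - t) = psi S t.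
Proof. by rewrite !psiSE; congr (- _); apply: eq_bigr => k _; rewrite ItfC. Qed.

Lemma psiS_ge S t : - dsum S <= psi S t.
Proof.
rewrite psiSE lerN2; apply: ler_sum => k _.
by rewrite ler_wpM2l ?divr_ge0// Itf_le_half.
Qed.

Lemma psiS_half S : psi S 2^-1 = - dsum S.
Proof. by rewrite psiSE. Qed.

Lemma psi_star_ge S a t : 0 <= t <= 1 -> a * t - psi S t <= psi_star S a.
Proof.
move=> t01; apply: ub_le_sup; last by exists t.
exists (`|a| + dsum S) => _ [u /= /andP[u0 u1] <-].
apply: lerD; last by rewrite lerNl psiS_ge.
by apply: le_trans (ler_norm _) _; rewrite normrM (ger0_norm u0) ler_piMr.
Qed.

Lemma psi_star_le S a x :
  (forall t, 0 <= t <= 1 -> a * t - psi S t <= x) -> psi_star S a <= x.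
Proof.
move=> h; apply: ge_sup; last by move=> _ [u /= u01 <-]; exact: h.
by exists (a * 0 - psi S 0), 0 => //=; rewrite lexx ler01.
Qed.

Lemma psi_star0 S : psi_star S 0 = dsum S.
Proof.
apply/eqP; rewrite eq_le; apply/andP; split.
  by apply: psi_star_le => t _; rewrite mul0r add0r lerNl psiS_ge.
have := @psi_star_ge S 0 2^-1; rewrite psiS_half; lra.
Qed.

(** Substitute 1-t for t, which leaves [psi] invariant. This turns the argument -2J in the odd rates
    into 2J, the form delivered by Chernoff bounds. *)
Lemma psi_starN S a : psi_star S (- a) + a = psi_star S a.
Proof.
apply/eqP; rewrite eq_le; apply/andP; split.
  rewrite -lerBrDr; apply: psi_star_le => t t01.
  by have := psi_star_ge S a (onem01 t01); rewrite psiSC; lra.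
apply: psi_star_le => t t01.
by have := psi_star_ge S (- a) (onem01 t01); rewrite psiSC; lra.
Qed.

Lemma psi_star_ge_half S a : a / 2 + dsum S <= psi_star S a.
Proof. by have := @psi_star_ge S a 2^-1; rewrite psiS_half; lra. Qed.

Lemma psi_star_le_add S a : 0 <= a -> psi_star S a <= a + dsum S.
Proof.
move=> a0; apply: psi_star_le => t /andP[t0 t1].
by apply: lerD; [rewrite ler_piMr | rewrite lerNl psiS_ge].
Qed.

(** A bound for every t passes to the supremum after taking logarithms. Since a >= 0, the values at
    t < 1/2 are dominated by those at 1-t, so t >= 1/2 suffices. *)
Lemma expR_psi_star S (P c kap a : R) : 0 < c -> 0 <= a ->
  (forall t, 2^-1 <= t <= 1 -> P <= expR (- (c * (a * t - psi S t)) + kap)) ->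
  P <= expR (- (c * psi_star S a) + kap).
Proof.
move=> c0 a0 hP; have [P0|P0] := leP P 0; first exact: le_trans P0 (expR_ge0 _).
have hP' t : 0 <= t <= 1 -> P <= expR (- (c * (a * t - psi S t)) + kap).
  move=> /andP[t0 t1]; have [t2|t2] := leP 2^-1 t; first by apply: hP; rewrite t2.
  have := hP (1 - t); rewrite psiSC => /(_ _)/le_trans; apply; first by lra.
  rewrite ler_expR lerD2r lerN2 (ler_pM2l c0) lerD2r ler_wpM2l//; lra.
rewrite -[P](@lnK R) ?posrE// ler_expR.
suff : psi_star S a <= (kap - ln P) / c by rewrite ler_pdivlMr//; lra.
apply: psi_star_le => t t01; rewrite ler_pdivlMr//.
have := hP' t t01; rewrite -[P in P <= _](@lnK R) ?posrE// ler_expR; lra.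
Qed.

Lemma expR_Jrho : expR (- (2 * J)) = 4 * (rho * (1 - rho)).
Proof.
have r0 : 0 < rho * (1 - rho) by have [r0 r2] := rho_bds; apply: mulr_gt0; lra.
rewrite /Jrho mulrN opprK mulrC expRM_natr lnK ?posrE ?mulr_gt0 ?sqrtr_gt0//.
by rewrite exprMn sqr_sqrtr ?ltW//; congr (_ * _); ring.
Qed.

Lemma Jrho_ge0 : 0 <= J.
Proof.
have r0 : 0 < rho * (1 - rho) by have [r0 r2] := rho_bds; apply: mulr_gt0; lra.
have : expR (- (2 * J)) <= expR 0.
  rewrite expR_Jrho expR0.
  by have := sqr_ge0 (1 - 2 * rho); rewrite expr2; lra.
by rewrite ler_expR; lra.
Qed.

Lemma rho_le_expJ : rho <= expR (- (2 * J)).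
Proof.
rewrite expR_Jrho; have : 0 <= rho * (3 - 4 * rho).
  by have [r0 r2] := rho_bds; apply: mulr_ge0; lra.
lra.
Qed.

Definition log_odds : R := ln ((1 - rho) / rho).
Local Notation lam := log_odds.

Lemma expR_log_odds : rho * expR lam = 1 - rho.
Proof.
have [r0 r2] := rho_bds; have r1 : 0 < 1 - rho by lra.
by rewrite lnK ?posrE ?divr_gt0// mulrC divfK// gt_eqF.
Qed.

Lemma log_odds_ge : 2 * J <= lam.
Proof.
rewrite -lerN2 -ler_expR expR_Jrho expRN.
have [r0 r2] := rho_bds; have r1 : 0 < 1 - rho by lra.
rewrite /log_odds lnK ?posrE ?divr_gt0// invf_div ler_pdivrMr//.
have -> : 4 * (rho * (1 - rho)) * (1 - rho) = rho * (2 * (1 - rho)) ^+ 2 by ring.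
by rewrite ler_peMr ?(ltW r0)// expr_ge1//; lra.
Qed.

(** Unlike [calI], this rate is additive over layers. It equals [calI] when the complement of [S] is
    even and is otherwise below it by at most J. *)
Definition rate_lb S : R := #|~: S|%:R * J + dsum S.

Lemma calI_even S : ~~ odd #|~: S| -> calI n rho p q S = rate_lb S.
Proof. by rewrite /calI /rate_lb => ->; rewrite psi_star0. Qed.

Lemma calI_odd S : odd #|~: S| ->
  calI n rho p q S = #|~: S|.-1%:R * J + psi_star S (2 * J).
Proof.
rewrite /calI => o; rewrite o /= -(psi_starN S (2 * J)); case: #|~: S| o => //= m _.
by rewrite -[m.+2]addn2 natrD; ring.
Qed.

Lemma calI_ge S : rate_lb S <= calI n rho p q S.
Proof.
have [od|ev] := boolP (odd #|~: S|); last by rewrite calI_even.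
rewrite calI_odd// /rate_lb; have := psi_star_ge_half S (2 * J).
by case: #|~: S| od => // m _; rewrite /= -[in m.+1%:R]addn1 natrD; lra.
Qed.

Lemma calI_le S : calI n rho p q S <= rate_lb S + J.
Proof.
have J0 := Jrho_ge0.
have [od|ev] := boolP (odd #|~: S|); last by rewrite calI_even//; lra.
rewrite calI_odd// /rate_lb.
have := @psi_star_le_add S (2 * J); case: #|~: S| od => // m _.
by rewrite /= -[in m.+1%:R]addn1 natrD; lra.
Qed.

Lemma calJ1 l : calJ n rho p q [set l] = psi_star [set l] (2 * J).
Proof. by rewrite /calJ cards1 /= -(psi_starN [set l] (2 * J)); ring. Qed.

Lemma dsum_le_calI S : dsum S <= calI n rho p q S.
Proof.
by apply: le_trans (calI_ge S); rewrite /rate_lb lerDr mulr_ge0 ?Jrho_ge0.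
Qed.

Lemma half_info_le_calJ l : half_info l <= calJ n rho p q [set l].
Proof.
rewrite calJ1; have := psi_star_ge_half [set l] (2 * J); rewrite big_set1.
by have := Jrho_ge0; lra.
Qed.

(* Layers in the complement of S split into a unflipped ones (each costing lam)
   and b flipped ones (each gaining lam); exchanging t and 1 - t reduces to
   b <= a, and then the extremal split is the balanced one. *)
Lemma partition_rate S (P c kap : R) (a b : nat) : 0 < c <= 1 ->
  (a + b = #|~: S|)%N ->
  (forall t, 0 <= t <= 1 -> P <= (rho * expR (t * lam)) ^+ b *
     expR (- (t * lam)) ^+ a * expR (c * psi S t + kap)) ->
  P <= expR (- (c * calI n rho p q S) + kap).
Proof.
move=> /andP[c0 c1] abm hP.
have J0 := Jrho_ge0; have lJ := log_odds_ge; have rJ := rho_le_expJ.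
have [r0 r2] := rho_bds.
(* In each of [h] pairs of a flipped and an overruled layer the log-odds cancel and rho remains; [g]
   surplus layers of the more frequent kind are left. *)
pose h := minn a b; pose g := (maxn a b - h)%N.
have key t : 2^-1 <= t <= 1 ->
    P <= expR (- (2 * J * h%:R + 2 * J * t * g%:R) + c * psi S t + kap).
  move=> t01.
  have rh : rho ^+ h <= expR (- (2 * J * h%:R)).
    rewrite -mulNr expRM_natr; apply: lerXn2r; rewrite ?nnegrE ?expR_ge0// ltW//.
  have lg : expR (- (t * lam)) ^+ g <= expR (- (2 * J * t * g%:R)).
    rewrite -expRM_natr ler_expR mulNr lerN2 ler_wpM2r// mulrC.
    by rewrite ler_wpM2l//; lra.
  have tr : rho ^+ h * expR (- (t * lam)) ^+ g * expR (c * psi S t + kap) <=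
      expR (- (2 * J * h%:R + 2 * J * t * g%:R) + c * psi S t + kap).
    rewrite -addrA [X in _ <= X]expRD ler_wpM2r ?expR_ge0// opprD expRD.
    by apply: ler_pM; rewrite ?exprn_ge0 ?expR_ge0// ltW.
  apply: le_trans tr; rewrite /g /h; have [ab|ba] := leqP a b.
    (* With flipped layers in the majority the bound is used at 1-t: rho e^{(1-t) lam} = (1-rho)
       e^{-t lam}, so a surplus flipped layer costs at least as much as a surplus overruled one at
       t. *)
    have := hP (1 - t); rewrite psiSC => /(_ _)/le_trans; apply; first by lra.
    rewrite ler_wpM2r ?expR_ge0// expr_mul_split//.
    have -> : rho * expR ((1 - t) * lam) * expR (- ((1 - t) * lam)) = rho.
      by rewrite -mulrA -expRD subrr expR0 mulr1.
    have -> : rho * expR ((1 - t) * lam) = (1 - rho) * expR (- (t * lam)).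
      by rewrite -expR_log_odds -mulrA -expRD; congr (_ * expR _); ring.
    rewrite ler_wpM2l ?exprn_ge0 ?(ltW r0)//.
    apply: lerXn2r; rewrite ?nnegrE ?mulr_ge0 ?expR_ge0//; first by lra.
    by rewrite ler_piMl ?expR_ge0//; lra.
  have := hP t => /(_ _)/le_trans; apply; first by lra.
  rewrite ler_wpM2r ?expR_ge0// mulrC expr_mul_split 1?ltnW//.
  have -> : expR (- (t * lam)) * (rho * expR (t * lam)) = rho.
    by rewrite mulrCA -expRD addNr expR0 mulr1.
  by [].
have hg : (2 * h + g = #|~: S|)%N.
  by rewrite -abm /g /h; case: (leqP a b) => ?; lia.
have le1 (x : R) : 0 <= x -> c * x <= x by move=> x0; rewrite ler_piMl.
have [od|ev] := boolP (odd #|~: S|); last first.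
  (* At t = 1/2 paired and surplus layers all cost J each. *)
  rewrite calI_even//; have h12 : 2^-1 <= (2^-1 : R) <= 1 by lra.
  apply: (le_trans (key _ h12)); rewrite ler_expR psiS_half lerD2r /rate_lb.
  have := le1 (#|~: S|%:R * J); rewrite mulr_ge0// => /(_ erefl).
  by rewrite -hg natrD natrM; lra.
rewrite calI_odd//.
have g1 : (0 < g)%N by move: od; rewrite -hg oddD oddM /=; case: (g).
rewrite mulrDr opprD -addrA [- _ + kap]addrC addrA [X in expR X]addrC.
apply: expR_psi_star => // [|t ht]; first by lra.
apply: (le_trans (key _ ht)); rewrite ler_expR.
have -> : #|~: S|.-1 = (2 * h + g.-1)%N by rewrite -hg -[in RHS]subn1 -subn1 addnBA.
have -> : g%:R = g.-1%:R + 1 :> R by rewrite natr1 prednK.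
have m0 : 0 <= (2 * h + g.-1)%:R * J + 2 * J * t.
  by rewrite addr_ge0 ?mulr_ge0//; lra.
have := le1 _ m0; rewrite natrD natrM.
(* As t >= 1/2, each surplus layer beyond the first costs 2Jt >= J, so a single surplus layer is the
   worst case. *)
have : 0 <= g.-1%:R * J * (2 * t - 1) by rewrite !mulr_ge0//; lra.
by lra.
Qed.

End Rates.

(** * Errors at one node *)

(** Here [x] is the estimate, [y] the truth and [s] the label of the node. Correctly placed nodes
    contribute the moment at t or 1-t according to their label, at least [N] of each kind, and
    further ones only factors at most 1; each of the at most [B] misplaced nodes pays the chi-square
    price. *)
Lemma prod_edge_mgf_le (R : realType) (V : finType) (p q C t N B : R)
  (x y : V -> bool) (s : bool) :
  0 < q -> q < p -> p <= 2^-1 -> p <= C * q -> 0 <= t <= 1 ->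
  N <= #|[set j | (x j != s) && (y j != s)]|%:R ->
  N <= #|[set j | (x j == s) && (y j == s)]|%:R ->
  #|[set j | x j != y j]|%:R <= B ->
  \prod_j edge_mgf p q t (x j != s) (y j == s) <=
  expR (- (N * Itf p q t) + B * (8 * C * Itf p q 2^-1)).
Proof.
move=> q0 qp p2 pC t01 N1 N2 hB.
have p1 : p < 1 by lra. have q1 : q < 1 by lra. have p0 : 0 < p by lra.
have hp : 0 < p < 1 by lra. have hq : 0 < q < 1 by lra.
have C0 : 0 < C by rewrite -(pmulr_lgt0 _ q0); lra.
have I0 : 0 <= Itf p q 2^-1 by apply: Itf_ge0 => //; lra.
have l1 := ln_lrm_le0 hp hq t01; have l2 := ln_lrm_le0 hp hq (onem01 t01).
pose e j := ln (lrm p q t) * ((x j != s) && (y j != s))%:R +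
  ln (lrm p q (1 - t)) * ((x j == s) && (y j == s))%:R +
  (8 * C * Itf p q 2^-1) * (x j != y j)%:R.
apply: (@le_trans _ _ (\prod_j expR (e j))).
  apply: ler_prod => j _; rewrite /edge_mgf /=; apply/andP; split.
    apply: addr_ge0; apply: mulr_ge0; rewrite ?expR_ge0//; case: (y j == s); lra.
  rewrite -/(edge_mgf p q t (x j != s) (y j == s)) /e.
  have [->|xy] := eqVneq (x j) (y j).
    rewrite !andbb mulr0 addr0.
    have := edge_mgf_lrm t (y j != s) hp hq; rewrite negbK => ->.
    by case: (y j == s); rewrite /= ?mulr0 mulr1 ?addr0 ?add0r lnK ?posrE ?lrm_gt0.
  have -> : (x j != s) = (y j == s) by move: xy; case: (x j); case: (y j); case: (s).
  have -> : (y j == s) && (y j != s) = false by case: (y j == s).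
  have -> : (x j == s) && (y j == s) = false.
    by move: xy; case: (x j); case: (y j); case: (s).
  by rewrite !mulr0 !add0r mulr1; apply: edge_mgf_wrong.
have sumc (P : pred V) : \sum_j (P j)%:R = #|[set j | P j]|%:R :> R.
  rewrite -sum1_card natr_sum big_mkcond [RHS]big_mkcond /=.
  by apply: eq_bigr => j _; rewrite inE; case: (P j).
rewrite -expR_sum ler_expR /e !big_split -!mulr_sumr /= !sumc.
apply: lerD; last by rewrite mulrC ler_wpM2r ?mulr_ge0// ltW.
rewrite Itf_lnD// -mulrN opprK mulrDr addrC; apply: lerD.
  by rewrite mulrC; apply: ler_wnM2r.
by rewrite mulrC; apply: ler_wnM2r.
Qed.

(** * Integrating out and redrawing the row of a node *)

Section RowMoments.
Variables (R : realType) (n L : nat) (rho : R) (p q : 'I_L -> R).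
Hypothesis rho01 : 0 <= rho <= 1.
Hypothesis p01 : forall k, 0 <= p k <= 1.
Hypothesis q01 : forall k, 0 <= q k <= 1.
Variable i : 'I_n.
Local Notation mu := (@coord_mean R n L rho p q).

Lemma coord_mean01 c : 0 <= mu c <= 1.
Proof. by case: c => [x|[[[k i1] j] []]] /=. Qed.

Lemma edge_coord_inj b (x : 'I_L * Vtx i) (x' : 'I_L * Vtx i) b' :
  edge_coord x.1 i (val x.2) b = edge_coord x'.1 i (val x'.2) b' -> x = x'.
Proof.
case: x x' => k j [k' j'] /=; have := valP j; have := valP j' => /= ij' ij.
rewrite /edge_coord; case: ltnP => h; case: ltnP => h' [] -> //.
- by move=> /val_inj ->.
- by move=> e2; case/eqP: ij'; exact: esym.
- by move=> e2; case/eqP: ij; exact: e2.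
- by move=> /val_inj ->.
Qed.

(** Redraw the edge coins with the flips frozen: the coins read by row [i] are then distinct
    coordinates and the inner expectation factors. The flips of [i] in different layers are
    independent, so the outer one factors too. *)
Lemma row_expect (zi : bool) (y : 'I_L -> Vtx i -> bool)
  (c : 'I_L -> bool -> R) (phi : 'I_L -> bool -> Vtx i -> bool -> R) :
  bern_expect mu (fun g => \prod_k (c k (g (inl (k, i))) *
    \prod_j phi k (g (inl (k, i))) j
      (g (edge_coord k i (val j) (addb zi (g (inl (k, i))) == y k j))))) =
  \prod_k \sum_z bern rho z * (c k z *
    \prod_j \sum_b bern (if addb zi z == y k j then p k else q k) b * phi k z j b).
Proof.
pose D (x : model_coord n L) := if x is inr _ then true else false.
rewrite (bern_expect_resample _ D).
transitivity (bern_expect mu (fun g => \prod_k (c k (g (inl (k, i))) *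
   \prod_j \sum_b bern (if addb zi (g (inl (k, i))) == y k j then p k else q k) b *
     phi k (g (inl (k, i))) j b))).
  apply: eq_bern_expect => f.
  pose iota (x : 'I_L * Vtx i) :=
    edge_coord x.1 i (val x.2) (addb zi (f (inl (x.1, i))) == y x.1 x.2).
  pose ph (x : 'I_L * Vtx i) := phi x.1 (f (inl (x.1, i))) x.2.
  transitivity (bern_expect mu (fun g => \prod_k c k (f (inl (k, i))) *
      \prod_x ph x (g (iota x)))).
    apply: eq_bern_expect => g; rewrite big_split /=; congr (_ * _).
      by apply: eq_bigr => k _; rewrite !ffunE.
    rewrite pair_bigA; apply: eq_bigr => -[k j] _ /=.
    rewrite /ph /iota /= !ffunE /=; congr (phi _ _ _ _).
    by rewrite /edge_coord; case: ltnP.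
  rewrite bern_expectZ bern_expect_inj_prod; last first.
    by move=> x x' /edge_coord_inj.
  rewrite big_split /= pair_bigA; congr (_ * _); apply: eq_bigr => -[k j] _ /=.
  apply: eq_bigr => b _; rewrite /ph /iota /=; congr (bern _ _ * _).
  by rewrite /edge_coord; case: ltnP.
have inj : injective (fun k => inl (k, i) : model_coord n L) by move=> k k' [].
rewrite (bern_expect_inj_prod mu (fun k z => c k z * \prod_j \sum_b
  bern (if addb zi z == y k j then p k else q k) b * phi k z j b) inj).
by [].
Qed.

End RowMoments.

(** Splicing along these coordinates keeps [f] away from node [i] and takes the flips and the row of
    [i] from an independent [g]; this implements conditioning on everything away from [i]. *)
Definition touches (n L : nat) (i : 'I_n) (c : model_coord n L) : bool :=
  match c with
  | inl (_, j) => j == i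
  | inr (_, j, j', _) => (j == i) || (j' == i)
  end.

Section Splice.
Variables (n L : nat) (zs : 'I_n -> bool) (i : 'I_n).
Variables f g : {ffun model_coord n L -> bool}.
Local Notation h := (splice (@touches n L i) f g).

Lemma flips_splice k : flips h (k, i) = g (inl (k, i)).
Proof. by rewrite !ffunE /= eqxx. Qed.

Lemma flips_splice_other k (j : 'I_n) : j != i -> flips h (k, j) = flips f (k, j).
Proof. by move=> ji; rewrite !ffunE /= (negbTE ji). Qed.

Lemma adjacency_splice k (j : 'I_n) : j != i -> adjacency zs h (k, i, j) =
  g (edge_coord k i j (addb (zs i) (g (inl (k, i))) == zind zs (flips f) k j)).
Proof.
move=> ji; rewrite ffunE eq_sym ji /= /zind flips_splice flips_splice_other//.
by rewrite ffunE /edge_coord; case: ltnP => _ /=; rewrite eqxx ?orbT.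
Qed.

Lemma adjacency_splice_other k (j j' : 'I_n) : j != i -> j' != i ->
  adjacency zs h (k, j, j') = adjacency zs f (k, j, j').
Proof.
move=> ji ji'; rewrite !ffunE /zind !flips_splice_other//; congr andb.
by rewrite ffunE /edge_coord; case: ltnP => _ /=; rewrite (negbTE ji) (negbTE ji').
Qed.

(** The leave-one-out initialization reads no entry involving node [i], hence is fixed under the
    conditioning. *)
Lemma tz_splice (Init : InitT n L) :
  tz Init (adjacency zs h) i = tz Init (adjacency zs f) i.
Proof.
rewrite /tz; congr (Init i _); apply/funext => k; apply/funext => j.
by apply/funext => j'; rewrite /delnet adjacency_splice_other ?(valP j) ?(valP j').
Qed.

End Splice.

(** * Decomposition of an error of the score maximizer *)

Section RowErrors.
Variables (R : realType) (n L : nat) (rho : R) (p q : 'I_L -> R).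
Hypothesis p01 : forall k, 0 < p k < 1.
Hypothesis q01 : forall k, 0 < q k < 1.
Variable i : 'I_n.
Local Notation lam := (log_odds rho).

(** Gain in the edge part of the layer-[k] score when the label of node [i] moves from [s] to its
    negation. *)
Definition row_llr (t : Vtx i -> bool) (k : 'I_L) (s : bool) (r : Vtx i -> bool) : R :=
  \sum_j (if t j != s then 1 else -1) * llr (p k) (q k) (r j).

Definition row_of (a : {ffun 'I_L * 'I_n * 'I_n -> bool}) (k : 'I_L) (j : Vtx i) : bool :=
  a (k, i, val j).

Lemma fsc_diff a (t : Vtx i -> bool) k ss ss' sl sl' :
  fsc rho p q a i t k ss sl - fsc rho p q a i t k ss' sl' =
  lam * ((sl == ss)%:R - (sl' == ss')%:R) +
  (if sl == sl' then 0 else row_llr t k sl' (row_of a k)).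
Proof.
have e ss0 sl0 : fsc rho p q a i t k ss0 sl0 = lam * (sl0 == ss0)%:R +
    \sum_j (t j == sl0)%:R * llr (p k) (q k) (row_of a k j).
  congr (_ + _); rewrite big_mkcond; apply: eq_bigr => j _ /=; rewrite llrE//.
  by case: (t j == sl0); rewrite ?mul1r ?mul0r.
rewrite !e mulrBr; set A := \sum_j _; set B := \sum_j _.
have -> : lam * (sl == ss)%:R + A - (lam * (sl' == ss')%:R + B) =
  lam * (sl == ss)%:R - lam * (sl' == ss')%:R + (A - B) by ring.
congr (_ + _); rewrite /A /B; case: eqVneq => [->|ne]; first by rewrite subrr.
rewrite -sumrB; apply: eq_bigr => j _; rewrite -mulrBl; congr (_ * _).
by move: ne; case: (t j); case: (sl); case: (sl') => //= _; ring.
Qed.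

Definition part_value (t : Vtx i -> bool) (s : bool)
  (a : {ffun 'I_L * 'I_n * 'I_n -> bool}) (k : 'I_L) (o : option bool) : R :=
  match o with
  | None => row_llr t k s (row_of a k)
  | Some true => lam
  | Some false => - lam
  end.

(* zt is the true global label of node i and xi its flips, both in the gauge of t.
   If the maximizer has the right global label, or layer l is flipped, the error
   is local to layer l; otherwise the global label is wrong and the layers
   are classified as kept (None), flipped (Some true) or overruled by the
   global label (Some false). *)
Lemma maximizer_error a (t : Vtx i -> bool) (zt : bool) (xi : 'I_L -> bool)
  (l : 'I_L) ss (sv : {ffun 'I_L -> bool}) :
  0 <= lam ->
  (forall ss' sv', score rho p q a i t ss' sv' <= score rho p q a i t ss sv) ->
  sv l != addb zt (xi l) ->
  [\/ xi l /\ - lam <= row_llr t l (addb zt (xi l)) (row_of a l),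
      ~~ xi l /\ lam <= row_llr t l (addb zt (xi l)) (row_of a l) |
      exists tau : {ffun 'I_L -> option bool},
        [/\ tau l = None,
            forall k, tau k = Some true -> xi k,
            forall k, tau k = None -> ~~ xi k &
            0 <= \sum_k part_value t zt a k (tau k)]].
Proof.
move=> lam0 hmax err.
(* The competitor differs from the maximizer in the label of layer [l] only. *)
have swap : 0 <= lam * ((sv l == ss)%:R - (addb zt (xi l) == ss)%:R) +
    row_llr t l (addb zt (xi l)) (row_of a l).
  pose sv' := [ffun k => if k == l then addb zt (xi l) else sv k].
  have := hmax ss sv'; rewrite -subr_ge0 /score -sumrB (bigD1 l)//= big1 => [|k kl].
    by rewrite addr0 fsc_diff ffunE eqxx (negbTE err).
  by rewrite ffunE (negbTE kl) subrr.
have svl : sv l = ~~ addb zt (xi l) by move: err; case: (sv l); case: (addb _ _).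
have [xl|xl] := boolP (xi l).
  constructor 1; split=> //; move: swap.
  have : lam * ((sv l == ss)%:R - (addb zt (xi l) == ss)%:R) <= lam.
    by case: (sv l == ss); case: (_ == ss); rewrite /= ?subrr ?subr0 ?sub0r; lra.
  by rewrite xl; lra.
have szt : addb zt (xi l) = zt by rewrite (negbTE xl) addbF.
have [e|ne] := eqVneq ss zt.
  constructor 2; split=> //; move: swap.
  rewrite svl szt e eqxx; have -> : ~~ zt == zt = false by case: (zt).
  by rewrite /= sub0r mulrN1 addbF; lra.
have {ne} ssE : ss = ~~ zt by move: ne; case: (ss); case: (zt).
constructor 3.
(* An unflipped layer other than [l] is given the larger of its edge gain and -lam; this choice
   decides between kept and overruled. *)
pose tau := [ffun k => if k == l then None else if xi k then Some true else
  if row_llr t k zt (row_of a k) <= - lam then Some false else None].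
exists tau; split.
- by rewrite ffunE eqxx.
- by move=> k; rewrite ffunE; case: (k == l) => //; case: (xi k) => //; case: ifP.
- move=> k; rewrite ffunE; case: eqVneq => [-> //|_]; by case: (xi k).
(* The competitor takes the right global label and gives it to all unflipped layers, [l] included;
   flipped layers stay as in the maximizer, which then gains at most lam on each. *)
pose sv' := [ffun k => if (k != l) && xi k then sv k else zt].
have := hmax zt sv'; rewrite -subr_ge0 => /le_trans; apply.
rewrite /score -sumrB; apply: ler_sum => k _; rewrite fsc_diff !ffunE.
have nzt : ~~ zt == zt = false by case: (zt).
have ztn : zt == ~~ zt = false by case: (zt).
have [->|kl] := eqVneq k l.
  by rewrite /= svl szt ssE !eqxx nzt /= subrr mulr0 add0r.
rewrite /= ssE; case: (xi k) => /=.
  rewrite eqxx addr0.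
  by case: (_ == ~~ zt); case: (_ == zt); rewrite /= ?subrr ?subr0 ?sub0r; lra.
rewrite eqxx; case: (sv k =P zt) => [->|/eqP svk].
  rewrite ztn /= sub0r mulrN1 addr0; case: ifP => //=.
  by move/negbT; rewrite -ltNge => /ltW.
have -> : sv k == ~~ zt by move: svk; case: (sv k); case: (zt).
by rewrite subrr mulr0 add0r; case: ifP.
Qed.

End RowErrors.

(** Some maximizer errs, which covers every tie-breaking. The sign [pi] carries the true labels to
    the gauge of the initialization. *)
Definition row_error (R : realType) (n L : nat) (rho : R) (p q : 'I_L -> R)
  (Init : InitT n L) (l : 'I_L) (i : 'I_n) (pi : bool) (zs : 'I_n -> bool)
  (o : Omega n L) : Prop :=
  exists ss, exists sv : {ffun 'I_L -> bool},
    (forall ss' sv', score rho p q o.2 i (tz Init o.2 i) ss' sv' <=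
                     score rho p q o.2 i (tz Init o.2 i) ss sv) /\
    sv l != addb pi (zind zs o.1 l i).

Definition kept (L : nat) (tau : {ffun 'I_L -> option bool}) : {set 'I_L} :=
  [set k | tau k == None].

(** * Error probability at a node, given everything away from it *)

Section NodeBound.
Variables (R : realType) (n L : nat) (rho : R) (p q : 'I_L -> R).
Variables (C c kap : R).
Hypothesis rho_bd : 0 < rho < 1 / 2.
Hypothesis q0 : forall k, 0 < q k.
Hypothesis qp : forall k, q k < p k.
Hypothesis p2 : forall k, p k <= 2^-1.
Hypothesis pC : forall k, p k <= C * q k.
Hypothesis c01 : 0 < c <= 1.
Variables (Init : InitT n L) (zs : 'I_n -> bool) (i : 'I_n) (l : 'I_L) (pi : bool).
Variable f : {ffun model_coord n L -> bool}.
Local Notation t := (tz Init (adjacency zs f) i).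
Local Notation y k j := (zind zs (flips f) k (val j)).
Hypothesis many_right : forall k b,
  c * (n%:R / 2) <= #|[set j : Vtx i | (t j == b) && (addb pi (y k j) == b)]|%:R.
Hypothesis few_wrong : forall k,
  #|[set j : Vtx i | t j != addb pi (y k j)]|%:R * (8 * C) <= kap * (n%:R / 2).

Local Notation h g := (splice (touches i) f g).
Local Notation lam := (log_odds rho).
Local Notation mu := (@coord_mean R n L rho p q).
Local Notation d := (half_info n p q).
Local Notation J := (Jrho rho).

Let p01 k : 0 < p k < 1. Proof. by have := q0 k; have := qp k; have := p2 k; lra. Qed.
Let q01 k : 0 < q k < 1. Proof. by have := q0 k; have := qp k; have := p2 k; lra. Qed.

Lemma lam_ge0 : 0 <= lam.
Proof. by have := log_odds_ge rho_bd; have := Jrho_ge0 rho_bd; lra. Qed.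

Lemma coord_mean_bd x : 0 <= mu x <= 1.
Proof.
apply: coord_mean01 => [|k|k]; first by have [? ?] := rho_bds rho_bd; lra.
- by have := p01 k; lra.
- by have := q01 k; lra.
Qed.

Definition layer_mgf_bound (u : R) (k : 'I_L) : R :=
  expR (c * - (n%:R / 2 * Itf (p k) (q k) u) + kap * d k).

Lemma bern_mean_edge_mgf (pr u : R) (b : bool) (k : 'I_L) (differ : bool) :
  pr = (if b then p k else q k) ->
  \sum_x bern pr x * expR (u * ((if differ then 1 else -1) * llr (p k) (q k) x)) =
  edge_mgf (p k) (q k) u differ b.
Proof. by move=> ->; rewrite big_bool. Qed.

(** [cc] carries factors depending only on the flip of node [i], and [use] selects the layers whose
    edge evidence is exponentiated. The expectation factors over layers, and each edge product is
    bounded by its moment with the mismatch cost. *)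
Lemma chernoff (u : R) (cc : 'I_L -> bool -> R) (use : pred 'I_L) :
  0 <= u <= 1 -> (forall k z, 0 <= cc k z) ->
  bern_expect mu (fun g => \prod_k (cc k (g (inl (k, i))) *
    (if use k then expR (u * row_llr p q t k (addb pi (addb (zs i) (g (inl (k, i)))))
       (row_of (adjacency zs (h g)) k)) else 1))) <=
  \prod_k \sum_z bern rho z * (cc k z *
    (if use k then layer_mgf_bound u k else 1)).
Proof.
move=> u01 cc0.
pose phi k z (j : Vtx i) b := if use k then
  expR (u * ((if t j != addb pi (addb (zs i) z) then 1 else -1) *
     llr (p k) (q k) b)) else 1.
rewrite (@eq_bern_expect _ _ _ _ (fun g => \prod_k (cc k (g (inl (k, i))) *
    \prod_j phi k (g (inl (k, i))) j
      (g (edge_coord k i (val j) (addb (zs i) (g (inl (k, i))) == y k j)))))); last first.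
  move=> g; apply: eq_bigr => k _; congr (_ * _); rewrite /phi.
  case: (use k); last by rewrite big1.
  rewrite mulr_sumr expR_sum; apply: eq_bigr => j _.
  by rewrite /row_of adjacency_splice// (valP j).
rewrite row_expect; have [r0 r2] := rho_bds rho_bd.
have b0 z : 0 <= bern rho z by case: z => /=; lra.
apply: ler_prod => k _; apply/andP; split.
  apply: sumr_ge0 => z _; rewrite mulr_ge0 ?mulr_ge0//; apply: prodr_ge0 => j _.
  rewrite big_bool /=; apply: addr_ge0; apply: mulr_ge0;
    rewrite /phi; case: (use k); rewrite ?expR_ge0//;
    case: ifP => _; have := p01 k; have := q01 k; lra.
apply: ler_sum => z _; rewrite ler_wpM2l// ler_wpM2l// /phi; case: (use k); last first.
  rewrite le_eqVlt big1 ?eqxx// => j _.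
  by rewrite big_bool /= !mulr1 addrC subrK.
have C0 : 0 < C by rewrite -(pmulr_lgt0 _ (q0 k)); have := pC k; have := qp k; have := q0 k; lra.
under eq_bigr => j _ do rewrite (@bern_mean_edge_mgf _ u (addb (zs i) z == y k j)) //.
pose s := addb pi (addb (zs i) z).
(* The mismatch budget is the one granted by [few_wrong]; at 8C times the information per node it
   costs exactly [kap * d k]. *)
have := @prod_edge_mgf_le R _ (p k) (q k) C u (c * (n%:R / 2))
  (kap * (n%:R / 2) / (8 * C)) t (fun j => addb pi (y k j)) s
  (q0 k) (qp k) (p2 k) (pC k) u01.
have -> : \prod_j edge_mgf (p k) (q k) u (t j != s) (addb pi (y k j) == s) =
   \prod_j edge_mgf (p k) (q k) u (t j != s) (addb (zs i) z == y k j).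
  apply: eq_bigr => j _; congr edge_mgf; rewrite /s eq_sym.
  by case: (pi); case: (addb _ z); case: (zind _ _ _ _).
move=> hle; apply: le_trans (hle _ _ _) _.
- have -> : [set j | (t j != s) && (addb pi (y k j) != s)] =
     [set j | (t j == ~~ s) && (addb pi (y k j) == ~~ s)].
    by apply/setP => j; rewrite !inE; case: (t j); case: (s); case: (addb _ _).
  exact: many_right.
- exact: many_right.
- by rewrite ler_pdivlMr ?mulr_gt0//; exact: few_wrong.
rewrite /layer_mgf_bound /half_info ler_expR le_eqVlt; apply/orP; left; apply/eqP.
by field; rewrite gt_eqF.
Qed.

Lemma prod_part_factor (x z : R) (e : 'I_L -> R) (tau : {ffun 'I_L -> option bool}) :
  \prod_k (match tau k with None => expR (e k) | Some true => x | Some false => z end) =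
  x ^+ (\sum_k (tau k == Some true)) * z ^+ (\sum_k (tau k == Some false)) *
  expR (\sum_(k in kept tau) e k).
Proof.
have -> : expR (\sum_(k in kept tau) e k) =
    \prod_k (if k \in kept tau then expR (e k) else 1).
  rewrite big_mkcond expR_sum; apply: eq_bigr => k _.
  by case: ifP => //; rewrite expR0.
rewrite !expr_sum -!big_split; apply: eq_bigr => k _ /=.
by rewrite inE; case: (tau k) => [[]|] /=; rewrite ?expr0 ?expr1 ?mulr1 ?mul1r.
Qed.

Lemma card_kept_compl (tau : {ffun 'I_L -> option bool}) :
  (\sum_k (tau k == Some false) + \sum_k (tau k == Some true))%N = #|~: kept tau|.
Proof.
rewrite -big_split -sum1_card [RHS]big_mkcond; apply: eq_bigr => k _ /=.
by rewrite !inE; case: (tau k) => [[]|].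
Qed.

Lemma sum_layer_exponent (u : R) (S : {set 'I_L}) :
  \sum_(k in S) (c * - (n%:R / 2 * Itf (p k) (q k) u) + kap * d k) =
  c * psiS n p q S u + kap * \sum_(k in S) d k.
Proof. by rewrite psiSE -sumrN !mulr_sumr -big_split. Qed.

(** Exponential Markov inequality for the sum of part values: a flipped layer contributes rho e^{u
    lam}, an overruled one e^{-u lam}, a kept one its edge moment, and [partition_rate] optimizes
    over u. *)
Lemma partition_prob (tau : {ffun 'I_L -> option bool}) :
  bern_expect mu (fun g => (`[< [/\ forall k, tau k = Some true -> g (inl (k, i)),
     forall k, tau k = None -> ~~ g (inl (k, i)) &
     0 <= \sum_k part_value rho p q t (addb pi (zs i)) (adjacency zs (h g)) k (tau k)] >])%:R) <=
  expR (- (c * calI n rho p q (kept tau)) + kap * \sum_(k in kept tau) d k).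
Proof.
have [r0 r2] := rho_bds rho_bd.
apply: (@partition_rate R n L rho p q rho_bd p01 q01 (kept tau) _ c
  _ (\sum_k (tau k == Some false)) (\sum_k (tau k == Some true)) c01).
  exact: card_kept_compl.
move=> u u01.
pose cc k (z : bool) := match tau k with None => (~~ z)%:R
  | Some true => z%:R * expR (u * lam) | Some false => expR (- (u * lam)) end.
pose use k := tau k == None.
have cc0 k z : 0 <= cc k z.
  by rewrite /cc; case: (tau k) => [[]|]; rewrite ?mulr_ge0 ?expR_ge0.
apply: le_trans (le_trans _ (chernoff use u01 cc0)) _.
  apply: le_bern_expect; first exact: coord_mean_bd.
  move=> g; case: asboolP => [[h1 h2 h3]|_]; last first.
    by apply: prodr_ge0 => k _; rewrite mulr_ge0//; case: ifP; rewrite ?expR_ge0.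
  rewrite (@eq_bigr _ _ _ _ _ _ _ (fun k => expR (u *
     part_value rho p q t (addb pi (zs i)) (adjacency zs (h g)) k (tau k)))).
    rewrite -expR_sum -mulr_sumr /= -[1%:R]expR0 ler_expR mulr_ge0//.
    by case/andP: u01.
  move=> k _; rewrite /cc /use /part_value; case e : (tau k) => [[]|] /=.
  - by rewrite (h1 _ e) mul1r mulr1.
  - by rewrite mulr1 mulrN.
  - by rewrite (negbTE (h2 _ e)) mul1r addbF.
rewrite -sum_layer_exponent -prod_part_factor; apply: ler_prod => k _.
rewrite big_bool /= /cc /use; case: (tau k) => [[]|] /=;
  rewrite ?mul1r ?mulr1 ?mul0r ?mulr0 ?add0r ?addr0.
- by rewrite mulr_ge0 ?expR_ge0 ?(ltW r0)//= lexx.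
- by rewrite -mulrDl addrC subrK mul1r expR_ge0 lexx.
- rewrite mulr_ge0 ?expR_ge0 ?ler_piMl ?expR_ge0//; lra.
Qed.

(** Chernoff's bound with tilt e^{-u lam} when unflipped. When flipped, the tilt rho e^{v lam} at v
    = 1-u equals (1-rho) e^{-u lam}, so both cases have the same rate. *)
Lemma local_prob (flipped : bool) :
  bern_expect mu (fun g => (`[< g (inl (l, i)) = flipped /\
     (if flipped then - lam else lam) <=
     row_llr p q t l (addb pi (addb (zs i) (g (inl (l, i)))))
       (row_of (adjacency zs (h g)) l) >])%:R) <=
  expR (- (c * calJ n rho p q [set l]) + kap * d l).
Proof.
have [r0 r2] := rho_bds rho_bd; have lJ := log_odds_ge rho_bd.
have J0 := Jrho_ge0 rho_bd.
pose sgn : R := if flipped then 1 else -1.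
have key u : 0 <= u <= 1 ->
    bern_expect mu (fun g => (`[< g (inl (l, i)) = flipped /\
     (if flipped then - lam else lam) <=
     row_llr p q t l (addb pi (addb (zs i) (g (inl (l, i)))))
       (row_of (adjacency zs (h g)) l) >])%:R) <=
    bern rho flipped * expR (u * (sgn * lam)) * layer_mgf_bound u l.
  move=> u01.
  pose cc k (z : bool) := if k == l then (z == flipped)%:R * expR (u * (sgn * lam)) else 1.
  have cc0 k z : 0 <= cc k z by rewrite /cc; case: ifP => _; rewrite ?mulr_ge0 ?expR_ge0.
  apply: le_trans (le_trans _ (chernoff (pred1 l) u01 cc0)) _.
    apply: le_bern_expect; first exact: coord_mean_bd.
    move=> g; case: asboolP => [[h1 h2]|_]; last first.
      by apply: prodr_ge0 => k _; rewrite mulr_ge0//; case: ifP; rewrite ?expR_ge0.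
    rewrite (bigD1 l)//= big1 => [|k kl]; last by rewrite /cc (negbTE kl) mulr1.
    rewrite mulr1 /cc eqxx h1 eqxx mul1r -expRD -mulrDr -[1%:R]expR0 ler_expR.
    rewrite mulr_ge0//; first by case/andP: u01.
    by move: h2; rewrite h1 /sgn; case: (flipped); lra.
  rewrite (bigD1 l)//= [X in _ * X]big1 => [|k kl].
    rewrite mulr1 /cc eqxx big_bool /=.
    by rewrite /sgn; case: (flipped); rewrite /= ?mul0r ?mulr0 ?addr0 ?add0r ?mul1r mulrA lexx.
  rewrite /cc (negbTE kl) /= mulr1.
  by under eq_bigr do rewrite mulr1; exact: sum_bern.
rewrite (calJ1 _ _ p01 q01); apply: expR_psi_star => [||u u01]; first by case/andP: c01.
  by lra.
have mE : layer_mgf_bound u l = expR (c * psiS n p q [set l] u + kap * d l).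
  by rewrite /layer_mgf_bound psiSE big_set1.
have [c0 c1] := andP c01; have [u2 u1] := andP u01.
suff [v v01 hv] : exists2 v, 0 <= v <= 1 & psiS n p q [set l] v = psiS n p q [set l] u /\
    bern rho flipped * expR (v * (sgn * lam)) <= expR (- (u * lam)).
  apply: (le_trans (key v v01)); case: hv => psi_v hv.
  have mEv : layer_mgf_bound v l = layer_mgf_bound u l.
    by rewrite mE -psi_v /layer_mgf_bound psiSE big_set1.
  rewrite mEv mE.
  apply: (@le_trans _ _ (expR (- (u * lam)) * expR (c * psiS n p q [set l] u + kap * d l))).
    by rewrite ler_wpM2r ?expR_ge0.
  rewrite -expRD ler_expR addrA lerD2r mulrBr opprB addrC lerD2l lerN2.
  have u0 : 0 <= u by apply: le_trans u2; rewrite invr_ge0.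
  apply: (@le_trans _ _ (2 * J * u)); first by rewrite ler_piMl ?mulr_ge0.
  by rewrite mulrC ler_wpM2l.
rewrite /sgn; case: flipped {key sgn} => /=.
  exists (1 - u); first by lra.
  split; first exact: psiSC.
  have -> : rho * expR ((1 - u) * (1 * lam)) = (rho * expR lam) * expR (- (u * lam)).
    by rewrite -mulrA -expRD; congr (_ * expR _); ring.
  by rewrite expR_log_odds// ler_piMl ?expR_ge0//; lra.
exists u; first by lra.
by split=> //; rewrite mulN1r mulrN ler_piMl ?expR_ge0//; lra.
Qed.

(** Union bound over the three cases of [maximizer_error]; the two local ones account for the factor
    2. *)
Lemma row_error_prob :
  bern_expect mu (fun g =>
    (`[< row_error rho p q Init l i pi zs (outcome zs (h g)) >])%:R) <=
  2 * expR (- (c * calJ n rho p q [set l]) + kap * d l) +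
  \sum_(tau : {ffun 'I_L -> option bool} | tau l == None)
    expR (- (c * calI n rho p q (kept tau)) + kap * \sum_(k in kept tau) d k).
Proof.
have H1 := local_prob true; have H2 := local_prob false.
have H3 := @ler_sum R _ (index_enum _) (fun tau : {ffun 'I_L -> option bool} => tau l == None)
  _ _ (fun tau _ => partition_prob tau).
have -> : 2 = 1 + 1 :> R by [].
rewrite mulrDl mul1r; apply: le_trans (lerD (lerD H1 H2) H3).
rewrite -bern_expect_sum -!bern_expectD; apply: le_bern_expect => [|g].
  exact: coord_mean_bd.
case: asboolP => [|_]; last by rewrite !addr_ge0//; apply: sumr_ge0.
move=> [ss [sv [hmax err]]]; rewrite /= in hmax err.
rewrite tz_splice in hmax.
move: err; rewrite /zind flips_splice addbA => err.
have := @maximizer_error R n L rho p q p01 q01 i _ t (addb pi (zs i))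
  (fun k => g (inl (k, i))) l ss sv lam_ge0 hmax err.
rewrite -addbA => -[[e1 e2]|[e1 e2]|[tau [t1 t2 t3 t4]]].
- rewrite (asboolT (conj e1 e2)) /= -addrA lerDl addr_ge0//; exact: sumr_ge0.
- rewrite (asboolT (conj (negbTE e1) e2)) /= addrAC lerDr addr_ge0//; exact: sumr_ge0.
- rewrite (bigD1 tau) ?t1//= (asboolT (And3 t2 t3 t4)) /= addrCA lerDl.
  by rewrite !addr_ge0//; apply: sumr_ge0.
Qed.

End NodeBound.

(** * Summing over partitions of the layers *)

Lemma sum_option_bool (R : zmodType) (F : option bool -> R) :
  \sum_o F o = F None + (F (Some true) + F (Some false)).
Proof.
rewrite (bigD1 None)//= (bigD1 (Some true))//= (bigD1 (Some false))//= big1 ?addr0//.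
by case=> [[]|].
Qed.

Section PartitionSum.
Variables (R : realType) (n L : nat) (rho : R) (p q : 'I_L -> R) (l : 'I_L).
Hypothesis rho_bd : 0 < rho < 1 / 2.
Hypothesis p01 : forall k, 0 < p k < 1.
Hypothesis q01 : forall k, 0 < q k < 1.
Implicit Types (S : {set 'I_L}) (tau : {ffun 'I_L -> option bool}).
Local Notation J := (Jrho rho).
Local Notation d := (half_info n p q).
Local Notation calI := (calI n rho p q).
Local Notation Imin := (Imin n rho p q l).

Lemma Imin_le S : l \in S -> Imin <= calI S.
Proof.
move=> lS; have <- : (S :\ l) :|: [set l] = S by rewrite finset.setUC finset.setD1K.
by apply: bigmin_le_cond; rewrite !inE eqxx.
Qed.

Lemma le_Imin x : (forall S, l \in S -> x <= calI S) -> x <= Imin.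
Proof.
move=> h; apply/bigmin_geP; split; first by apply: h; rewrite inE.
by move=> S lS; apply: h; rewrite !inE eqxx orbT.
Qed.

Lemma rate_lbE S : rate_lb n rho p q S = \sum_k (if k \in S then d k else J).
Proof.
rewrite /rate_lb [RHS](bigID (mem S)) /= [LHS]addrC; congr (_ + _).
  by apply: eq_bigr => k ->.
rewrite (eq_bigr (fun _ => J)) => [|k /negbTE ->//].
rewrite sumr_const mulr_natl; congr (_ *+ _).
by apply: eq_card => k; rewrite !inE.
Qed.

Variables (e0 : R).
Hypothesis e01 : 0 < e0 <= 1.

Definition strong_layers : {set 'I_L} := [set k | (k != l) && (e0 * J < d k)].
Local Notation U := strong_layers.

(** Kept or dropped, a strong layer adds at least e0 J to the additive rate of every admissible
    set. *)
Lemma card_strong_le : #|U|%:R * (e0 * J) <= Imin.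
Proof.
have J0 := Jrho_ge0 rho_bd; have [e0_gt0 e0_le1] := andP e01.
apply: le_Imin => S lS; apply: le_trans (calI_ge n rho p01 q01 S).
rewrite rate_lbE -sum1_card natr_sum mulr_suml big_mkcond /=.
apply: ler_sum => k _; rewrite inE; have d0 := half_info_ge0 n p01 q01 k.
case: andP => [[_ /ltW hk]|_]; last by case: ifP.
by rewrite mul1r; case: ifP => // _; rewrite ler_piMl.
Qed.

Definition weak_dropped (tau : {ffun 'I_L -> option bool}) : {set 'I_L} :=
  [set k | [&& k != l, k \notin U & tau k != None]].

(* dropping back the weak layers changes the parity at most once, which costs J *)
Lemma calI_kept_ge tau : tau l = None ->
  Imin + #|weak_dropped tau|%:R * ((1 - e0) * J) - J <= calI (kept tau).
Proof.
move=> tl; set D := weak_dropped tau; have J0 := Jrho_ge0 rho_bd.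
apply: le_trans (calI_ge n rho p01 q01 _).
have h1 : Imin <= calI (kept tau :|: D) by apply: Imin_le; rewrite !inE tl.
have h2 := calI_le n rho_bd p01 q01 (kept tau :|: D).
suff : rate_lb n rho p q (kept tau :|: D) + #|D|%:R * ((1 - e0) * J) <=
    rate_lb n rho p q (kept tau) by lra.
rewrite !rate_lbE -sum1_card natr_sum mulr_suml [X in _ + X]big_mkcond -big_split /=.
apply: ler_sum => k _; rewrite finset.in_setU; have [kD|kD] := boolP (k \in D); last first.
  by rewrite orbF addr0.
have : k \notin kept tau by move: kD; rewrite !inE => /and3P[].
move=> /negbTE ->; rewrite /= mul1r.
move: kD; rewrite !inE => /and3P[-> /=]; rewrite -leNgt => dk _; lra.
Qed.

(** The summand is a product over layers, so the sum factors: 3 choices for a strong layer, 1 + 2y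
    <= e^{2y} for a weak one, and a single choice for [l]. *)
Lemma sum_weak_dropped (y : R) : 0 <= y ->
  \sum_(tau : {ffun 'I_L -> option bool} | tau l == None) y ^+ #|weak_dropped tau| <=
  3 ^+ #|U| * expR (2 * y * L%:R).
Proof.
move=> y0.
pose w k (o : option bool) : R := if k == l then (o == None)%:R else
  if k \in U then 1 else if o is None then 1 else y.
have -> : \sum_(tau : {ffun 'I_L -> option bool} | tau l == None)
    y ^+ #|weak_dropped tau| =
    \sum_(tau : {ffun 'I_L -> option bool}) \prod_k w k (tau k).
  rewrite big_mkcond; apply: eq_bigr => tau _; case: eqP => [tl|tl]; last first.
    by rewrite (bigD1 l)//= /w eqxx; move/eqP/negbTE: tl => ->; rewrite mul0r.
  rewrite -sum1_card expr_sum [LHS]big_mkcond /=; apply: eq_bigr => k _.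
  rewrite finset.in_set /w; case: eqVneq => [->|kl] /=; first by rewrite tl eqxx.
  by case: (k \in U) => //=; case: (tau k).
rewrite -bigA_distr_bigA.
apply: (@le_trans _ _ (\prod_k ((if k \in U then 3 else 1) * expR (2 * y)))).
  apply: ler_prod => k _; rewrite sum_option_bool /w.
  have e1 := expR_ge1Dx (2 * y); have y2 : 0 <= 2 * y by rewrite mulr_ge0.
  case: (k == l) => /=.
    rewrite !addr0 ler01 /=; case: ifP => _; lra.
  by case: ifP => _; apply/andP; split; lra.
rewrite big_split /= prodr_const card_ord -expRM_natr -!big_mkcond /= prodr_const.
by rewrite lexx.
Qed.

Variables (c c' : R) (K : nat).
Hypothesis c01 : 0 < c <= 1.
Hypothesis K0 : (0 < K)%N.
Hypothesis c'_le : c' <= c * (1 - e0 - K%:R^-1).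

(** Split on the number N of dropped weak layers. For N <= K the exponent is at most -c [Imin], and
    inserting L^K L^{-N} >= 1 makes the sum converge at weight 1/L per layer; for N > K each dropped
    layer brings a factor e^{-c' J}. Both are sums over [weak_dropped]. *)
Lemma sum_expR_calI :
  \sum_(tau : {ffun 'I_L -> option bool} | tau l == None)
    expR (- (c * calI (kept tau))) <=
  expR (- (c * Imin)) * (3 ^+ #|U| *
    (expR 2 * L%:R ^+ K + expR (2 * expR (- (c' * J)) * L%:R))).
Proof.
have J0 := Jrho_ge0 rho_bd; have [c0 c1] := andP c01.
have L0 : 0 < L%:R :> R by rewrite ltr0n; case: (L) l => // -[].
pose y := expR (- (c' * J)).
have key (tau : {ffun 'I_L -> option bool}) : tau l == None ->
    expR (- (c * calI (kept tau))) <= expR (- (c * Imin)) *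
     (L%:R ^+ K * L%:R^-1 ^+ #|weak_dropped tau| + y ^+ #|weak_dropped tau|).
  move=> /eqP tl; have hI := calI_kept_ge tl.
  set N := #|_| in hI *; have [NK|KN] := leqP N K.
    have hI2 : Imin <= calI (kept tau) by apply: Imin_le; rewrite inE tl.
    apply: (@le_trans _ _ (expR (- (c * Imin)) * 1)).
      by rewrite mulr1 ler_expR lerN2 ler_wpM2l// ltW.
    rewrite ler_wpM2l ?expR_ge0//.
    apply: (@le_trans _ _ (L%:R ^+ K * L%:R^-1 ^+ N)); last first.
      by rewrite lerDl exprn_ge0 ?expR_ge0.
    rewrite exprVn ler_pdivlMr ?exprn_gt0// mul1r; apply: ler_weXn2l => //.
    by rewrite ler1n; case: (L) l => // -[].
  apply: (@le_trans _ _ (expR (- (c * Imin)) * y ^+ N)); last first.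
    by rewrite ler_wpM2l ?expR_ge0// lerDr mulr_ge0 ?exprn_ge0 ?invr_ge0 ?(ltW L0).
  rewrite /y -expRM_natr -expRD ler_expR.
  have h1 : c * (Imin + N%:R * ((1 - e0) * J) - J) <= c * calI (kept tau).
    by rewrite ler_wpM2l// ltW.
  have KR : 0 < K%:R :> R by rewrite ltr0n.
  (* The parity loss J is spread over more than K layers, at most J/K for each. *)
  have h2 : 1 <= N%:R * K%:R^-1 :> R by rewrite ler_pdivlMr// mul1r ler_nat ltnW.
  have h3 : c' * (J * N%:R) <= c * (1 - e0 - K%:R^-1) * (J * N%:R).
    by rewrite ler_wpM2r// mulr_ge0.
  have h4 : c * J * 1 <= c * J * (N%:R * K%:R^-1).
    by rewrite ler_wpM2l// mulr_ge0// ltW.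
  lra.
apply: (@le_trans _ _ (\sum_(tau : {ffun 'I_L -> option bool} | tau l == None)
  expR (- (c * Imin)) *
     (L%:R ^+ K * L%:R^-1 ^+ #|weak_dropped tau| + y ^+ #|weak_dropped tau|))).
  exact: ler_sum.
rewrite -mulr_sumr ler_wpM2l ?expR_ge0// big_split /= -mulr_sumr mulrDr.
apply: lerD; last first.
  exact: sum_weak_dropped (expR_ge0 _).
rewrite mulrA [X in _ <= X]mulrC ler_wpM2l ?exprn_ge0 ?(ltW L0)//.
have L1 : 0 <= L%:R^-1 :> R by rewrite invr_ge0 ltW.
have := sum_weak_dropped L1.
by rewrite -mulrA mulVf ?gt_eqF// mulr1.
Qed.

End PartitionSum.

(** * Alignment *)

Lemma card_le_or (T : finType) (P Q S : pred T) :
  (forall x, P x -> Q x || S x) ->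
  (#|[set x | P x]| <= #|[set x | Q x]| + #|[set x | S x]|)%N.
Proof.
move=> h; apply: leq_trans (leq_card_setU _ _); apply: subset_leq_card.
by apply/fintype.subsetP => x; rewrite !inE => /h.
Qed.

(* The comprehensions [set x | P x] of the statement elaborate to classical sets. *)
Lemma card_classic (T : finType) (P : pred T) :
  #|[set x | P x]%classic| = #|[set x | P x]|.
Proof. by apply: eq_card => x; rewrite finset.in_set; apply: asboolb. Qed.

Lemma card_val_Vtx (n : nat) (i : 'I_n) (P : pred 'I_n) :
  #|[set j : Vtx i | P (val j)]| = #|[set val j | j in [set j : Vtx i | P (val j)]]|.
Proof. by rewrite card_imset//; exact: val_inj. Qed.

Lemma card_Vtx_ge (n : nat) (i : 'I_n) (P : pred 'I_n) :
  (#|[set j | P j]| <= #|[set j : Vtx i | P (val j)]|.+1)%N.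
Proof.
rewrite card_val_Vtx.
rewrite -addn1 -(cards1 i); apply: leq_trans (leq_card_setU _ _).
apply: subset_leq_card; apply/fintype.subsetP => j; rewrite !inE => Pj.
have [->|ji] := eqVneq j i; first by rewrite orbT.
by rewrite orbF; apply/imsetP; exists (exist _ j ji); rewrite ?inE.
Qed.

Lemma card_Vtx_le (n : nat) (i : 'I_n) (P : pred 'I_n) :
  (#|[set j : Vtx i | P (val j)]| <= #|[set j | P j]|)%N.
Proof.
rewrite card_val_Vtx; apply: subset_leq_card.
by apply/fintype.subsetP => x /imsetP[j jP ->]; move: jP; rewrite !inE.
Qed.

(** The sign attaining the minimum in [dH_init], [true] meaning a global flip; a tie gives no
    flip. *)
Definition gauge (n : nat) (i : 'I_n) (t : Vtx i -> bool) (zs : 'I_n -> bool) : bool :=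
  ~~ (#|[set j : Vtx i | t j != zs (val j)]| <=
      #|[set j : Vtx i | ~~ t j != zs (val j)]|)%N.

Lemma dH_init_gauge (n : nat) (i : 'I_n) (t : Vtx i -> bool) (zs : 'I_n -> bool) :
  dH_init t zs = #|[set j : Vtx i | t j != addb (gauge t zs) (zs (val j))]|.
Proof.
rewrite /dH_init !card_classic /gauge.
case: leqP => h //=; apply: eq_card => j; rewrite !inE.
by case: (t j); case: (zs _).
Qed.

Section Alignment.
Variables (R : realType) (n L : nat) (rho : R) (p q : 'I_L -> R).
Variables (Init : InitT n L) (zs : 'I_n -> bool).
Variables (xi : {ffun 'I_L * 'I_n -> bool}) (a : {ffun 'I_L * 'I_n * 'I_n -> bool}).
Variables (l : 'I_L) (e : nat).
Local Notation t i := (tz Init a i).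
Local Notation pi i := (gauge (t i) zs).
Hypothesis init_close : forall i, (dH_init (t i) zs <= e)%N.
Hypothesis clusters_large : forall b, (4 * e.+1 < #|[set i | zs i == b]|)%N.

Lemma ext_self (i : 'I_n) (u : Vtx i -> bool) b : ext i u b i = b.
Proof.
by rewrite /ext; case: insubP => // x /negP; rewrite eqxx.
Qed.

(** The additional mismatch allows for node [i] itself, on which the initialization is undefined. *)
Lemma ext_mismatch i b :
  (#|[set j | ext i (t i) b j != addb (pi i) (zs j)]| <= e.+1)%N.
Proof.
apply: leq_trans (card_Vtx_ge i _) _; rewrite ltnS; apply: leq_trans (init_close i).
rewrite dH_init_gauge; apply: eq_leq; apply: eq_card => j.
by rewrite !inE /ext valK.
Qed.

(** The first run and run [i] each match the global labels up to gauge outside e+1 nodes. The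
    overlap for the right sign therefore misses at most 2(e+1) nodes of a cluster of more than
    4(e+1), while the other overlap has at most 2(e+1) nodes. *)
Lemma alg3_out_aligned (zhat : 'I_n -> bool) : (0 < n)%N ->
  alg3_out rho p q Init a l zhat ->
  exists pi0, forall i, zhat i = addb pi0 (zind zs xi l i) \/
    row_error rho p q Init l i (pi i) zs (xi, a).
Proof.
move=> n0 [sbar [hmax [hfirst halign]]].
pose i0 : 'I_n := Ordinal n0; exists (pi i0) => i.
have [good|bad] := eqVneq ((sbar i).2 l) (addb (pi i) (zind zs xi l i)); last first.
  by right; exists (sbar i).1, (sbar i).2; split=> // ss' sv'; exact: hmax.
left; have [i_0|i_gt0] := posnP (val i).
  have e0 : i = i0 by apply: val_inj.
  by rewrite hfirst// good e0.
pose bz i' := ext i' (t i') ((sbar i').2 l).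
have := halign i i0 i_gt0 erefl; rewrite /= => hs.
have bii : bz i i = (sbar i).2 l by rewrite /bz ext_self.
(* The estimate at [i] carried from the gauge of run [i] to that of the first run. *)
pose s := addb (addb ((sbar i).2 l) (pi i)) (pi i0).
suff : zhat i = s by rewrite /s good => ->; case: (pi i); case: (pi i0); case: (zind _ _ _ _).
apply/eqP; apply: contraT => ns.
have zE : zhat i = ~~ s by move: ns; case: (zhat i); case: (s).
have m1 := ext_mismatch i ((sbar i).2 l); have m0 := ext_mismatch i0 ((sbar i0).2 l).
have := hs s; rewrite !card_classic zE -!/(bz _ _).
rewrite -[ext i0 _ _]/(bz i0) -[ext i _ _]/(bz i) bii leqNgt => /negP[].
have big := clusters_large (addb ((sbar i).2 l) (pi i)).
set M := fun j => (bz i j != addb (pi i) (zs j)) || (bz i0 j != addb (pi i0) (zs j)).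
have cM : (#|[set j | M j]| <= e.+1 + e.+1)%N.
  by apply: leq_trans (leq_add m1 m0); apply: card_le_or.
have up : (#|[set j | (bz i0 j == ~~ s) && (bz i j == (sbar i).2 l)]| <= #|[set j | M j]|)%N.
  apply: subset_leq_card; apply/fintype.subsetP => j; rewrite !inE /M /s.
  by case: (bz i j); case: (bz i0 j); case: (zs j); case: (pi i); case: (pi i0);
    case: ((sbar i).2 l).
have lo : (#|[set j | zs j == addb ((sbar i).2 l) (pi i)]| <=
    #|[set j | (bz i0 j == s) && (bz i j == (sbar i).2 l)]| + #|[set j | M j]|)%N.
  apply: card_le_or => j; rewrite /M /s.
  by case: (bz i j); case: (bz i0 j); case: (zs j); case: (pi i); case: (pi i0);
    case: ((sbar i).2 l).
lia.
Qed.

Lemma loss_le_row_errors (zhat : 'I_n -> bool) : (0 < n)%N ->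
  alg3_out rho p q Init a l zhat ->
  loss zhat (zind zs xi l) <=
  (\sum_i `[< row_error rho p q Init l i (pi i) zs (xi, a) >]%:R) / n%:R :> R.
Proof.
move=> n0 /(alg3_out_aligned n0)[pi0 h].
rewrite /loss /dH !card_classic ler_wpM2r ?invr_ge0// -natr_sum ler_nat.
have -> : (\sum_i `[< row_error rho p q Init l i (pi i) zs (xi, a) >])%N =
    #|[set i | `[< row_error rho p q Init l i (pi i) zs (xi, a) >]]|.
  rewrite -sum1_card [RHS]big_mkcond; apply: eq_bigr => i _.
  by rewrite inE; case: `[< _ >].
have sub (z' : 'I_n -> bool) : (forall i, z' i = addb pi0 (zhat i)) ->
    (#|[set i | z' i != zind zs xi l i]| <= #|[set i | `[< row_error rho p q Init l i (pi i) zs (xi, a) >]]|)%N.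
  move=> z'E; apply: subset_leq_card; apply/fintype.subsetP => i; rewrite !inE z'E => ne.
  case: (h i) => [e1|]; last by [].
  by move: ne; rewrite e1; case: (pi0); case: (zind _ _ _ _).
rewrite geq_min; apply/orP; case: pi0 h sub => h sub; [right|left]; exact: sub.
Qed.

End Alignment.

Section GoodEvent.
Variables (R : realType) (n L : nat) (zs : 'I_n -> bool) (i : 'I_n).
Variables (t : Vtx i -> bool) (xi : {ffun 'I_L * 'I_n -> bool}) (pi : bool).

Lemma card_wrong_le k :
  (#|[set j : Vtx i | t j != addb pi (zind zs xi k (val j))]| <=
   #|[set j : Vtx i | t j != addb pi (zs (val j))]| +
   #|[set j : Vtx i | xi (k, val j)]|)%N.
Proof.
by apply: card_le_or => j; rewrite /zind; case: (t j); case: (pi); case: (zs _); case: (xi _).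
Qed.

Lemma card_right_ge k b :
  (#|[set j | zs j == addb pi b]| <=
   #|[set j : Vtx i | (t j == b) && (addb pi (zind zs xi k (val j)) == b)]| +
   (#|[set j : Vtx i | t j != addb pi (zs (val j))]| +
   #|[set j : Vtx i | xi (k, val j)]|).+1)%N.
Proof.
apply: leq_trans (card_Vtx_ge i _) _; rewrite addnS ltnS.
apply: (@leq_trans (#|[set j : Vtx i | (t j == b) && (addb pi (zind zs xi k (val j)) == b)]| +
  #|[set j : Vtx i | (t j != addb pi (zs (val j))) || xi (k, val j)]|)).
  apply: card_le_or => j; rewrite /zind.
  by case: (t j); case: (pi); case: (zs _); case: (xi _); case: (b).
by rewrite leq_add2l; apply: card_le_or.
Qed.

End GoodEvent.

(** * Finite-sample bound *)

Section FiniteSample.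
Variables (R : realType) (n L : nat) (rho : R) (p q : 'I_L -> R).
Variables (C beta delta : R).
Hypothesis n0 : (0 < n)%N.
Hypothesis rho_bd : 0 < rho < 1 / 2.
Hypothesis q0 : forall k, 0 < q k.
Hypothesis qp : forall k, q k < p k.
Hypothesis p2 : forall k, p k <= 2^-1.
Hypothesis pC : forall k, p k <= C * q k.
Variables (Init : InitT n L) (zs : 'I_n -> bool) (l : 'I_L).
Hypothesis beta0 : 0 < beta.
Hypothesis bal : balanced beta zs.
Hypothesis delta0 : 0 <= delta.

Local Notation mu := (@coord_mean R n L rho p q).
Local Notation d := (half_info n p q).
Local Notation J := (Jrho rho).

Let p01 k : 0 < p k < 1. Proof. by have := q0 k; have := qp k; have := p2 k; lra. Qed.
Let q01 k : 0 < q k < 1. Proof. by have := q0 k; have := qp k; have := p2 k; lra. Qed.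
Let mu01 x : 0 <= mu x <= 1. Proof. exact: coord_mean_bd. Qed.
Let nR : 0 < n%:R :> R. Proof. by rewrite ltr0n. Qed.

Lemma C_gt0 : 0 < C.
Proof.
rewrite -(pmulr_lgt0 _ (q0 l)); apply: lt_le_trans (pC l).
by apply: lt_trans (qp l).
Qed.

(** Chosen so that n [flip_level] flips, weighted by -ln rho each, amount to 2n; it vanishes with
    rho. *)
Definition flip_level : R := 2 / - ln rho.
Local Notation eta := flip_level.

Lemma ln_rho_lt0 : ln rho < 0.
Proof. by have [r0 r2] := rho_bds rho_bd; apply: ln_lt0; lra. Qed.

Lemma flip_level_ge0 : 0 <= eta.
Proof. by rewrite /flip_level divr_ge0// oppr_ge0 ltW// ln_rho_lt0. Qed.

(** Chernoff's bound with exponent -ln rho: each flip variable has moment 1 + (1 - rho) <= e, so the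
    total is at most e^{-2n} e^n. *)
Lemma flip_tail (k : 'I_L) :
  bern_expect mu (fun w => (n%:R * eta < #|[set j | flips w (k, j)]|%:R)%R%:R) <=
  expR (- n%:R).
Proof.
have [r0 r2] := rho_bds rho_bd; have lr := ln_rho_lt0.
pose phi (j : 'I_n) (b : bool) : R := if b then rho^-1 else 1.
have inj : injective (fun j : 'I_n => inl (k, j) : model_coord n L) by move=> j j' [].
apply: (@le_trans _ _ (bern_expect mu (fun w => expR (- (2 * n%:R)) *
    \prod_j phi j (w (inl (k, j)))))).
  apply: le_bern_expect => // w.
  have -> : \prod_j phi j (w (inl (k, j))) =
      expR (- ln rho * #|[set j | flips w (k, j)]|%:R).
    rewrite -sum1_card natr_sum mulr_sumr expR_sum [RHS]big_mkcond.
    apply: eq_bigr => j _; rewrite /= !inE ffunE /phi mulr1.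
    by case: (w _) => //; rewrite expRN lnK.
  rewrite -expRD; case: ltP => [h|_]; last exact: expR_ge0.
  rewrite -[true%:R]expR0 ler_expR.
  have : - ln rho * (n%:R * eta) <= - ln rho * #|[set j | flips w (k, j)]|%:R.
    by rewrite ler_wpM2l ?(ltW h)// oppr_ge0 ltW.
  have -> : - ln rho * (n%:R * eta) = 2 * n%:R.
    by rewrite /flip_level; field; rewrite lt_eqF.
  lra.
rewrite bern_expectZ (bern_expect_inj_prod mu phi inj).
have -> : - n%:R = - (2 * n%:R) + n%:R :> R by ring.
rewrite expRD ler_wpM2l ?expR_ge0//.
rewrite -[X in expR X]mul1r expRM_natr -[n in X in _ <= X]card_ord -prodr_const.
apply: ler_prod => j _; rewrite big_bool /= /phi mulr1 divff ?gt_eqF//.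
have := @expR_ge1Dx R 1; lra.
Qed.

(** Depends only on coordinates not touching [i], so it is decided before the row of [i] is
    drawn. *)
Definition good_node (i : 'I_n) (w : {ffun model_coord n L -> bool}) : Prop :=
  (dH_init (tz Init (adjacency zs w) i) zs)%:R <= n%:R * delta /\
  forall k, #|[set j : Vtx i | flips w (k, val j)]|%:R <= n%:R * eta.

Definition node_error (i : 'I_n) (w : {ffun model_coord n L -> bool}) : Prop :=
  row_error rho p q Init l i (gauge (tz Init (adjacency zs w) i) zs) zs (outcome zs w).

Variables (c : R).
Hypothesis c01 : 0 < c <= 1.
Hypothesis c_le : c <= beta^-1 - 2 * delta - 2 * eta - 2 / n%:R.
(** At most n(delta + eta) misplaced nodes at 8C times the information, in units of n/2 times the
    information. *)
Definition mismatch_loss : R := 16 * C * (delta + eta).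
Local Notation kap := mismatch_loss.

Lemma cluster_ge b : n%:R / (2 * beta) <= #|[set j | zs j == b]|%:R :> R.
Proof.
have [/andP[h1 _] /andP[h2 _]] := bal; rewrite !card_classic in h1 h2.
case: b.
  by apply: le_trans h1 _; rewrite le_eqVlt; apply/orP; left; apply/eqP; congr _%:R; apply: eq_card => j; rewrite !inE eqb_id.
by apply: le_trans h2 _; rewrite le_eqVlt; apply/orP; left; apply/eqP; congr _%:R; apply: eq_card => j; rewrite !inE eqbF_neg.
Qed.

(** Condition on the coordinates away from [i]. If the node is bad the event is empty; otherwise
    each cluster, less misplaced nodes, flipped nodes and [i] itself, still has c n/2 well-placed
    nodes and [row_error_prob] applies. *)
Lemma node_error_prob i :
  bern_expect mu (fun w => (`[< good_node i w /\ node_error i w >])%:R) <=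
  2 * expR (- (c * calJ n rho p q [set l]) + kap * d l) +
  \sum_(tau : {ffun 'I_L -> option bool} | tau l == None)
    expR (- (c * calI n rho p q (kept tau)) + kap * \sum_(k in kept tau) d k).
Proof.
have C0 := C_gt0.
set r := (X in _ <= X); have r0 : 0 <= r.
  by rewrite addr_ge0 ?mulr_ge0 ?expR_ge0//; apply: sumr_ge0 => tau _; rewrite expR_ge0.
rewrite (bern_expect_resample mu (touches i)).
rewrite -(bern_expect_cst mu r); apply: le_bern_expect => // f.
have tzE g : tz Init (adjacency zs (splice (touches i) f g)) i =
  tz Init (adjacency zs f) i by exact: tz_splice.
have flE g k : #|[set j : Vtx i | flips (splice (touches i) f g) (k, val j)]| =
    #|[set j : Vtx i | flips f (k, val j)]|.
  by apply: eq_card => j; rewrite !inE flips_splice_other// (valP j).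
have [gd|ngd] := pselect (good_node i f); last first.
  rewrite -(bern_expect_cst mu r); apply: le_bern_expect => // g.
  rewrite asboolF//= => -[[h1 h2] _]; apply: ngd; split; first by rewrite -(tzE g).
  by move=> k; rewrite -(flE g).
set t := tz Init (adjacency zs f) i; set pi := gauge t zs.
have [gd1 gd2] := gd; rewrite dH_init_gauge -/t -/pi in gd1.
apply: le_trans (@row_error_prob R n L rho p q C c kap rho_bd q0 qp p2 pC c01
  Init zs i l pi f _ _).
- apply: le_bern_expect => // g; rewrite ler_nat /node_error /= tzE -/t -/pi.
  by case: asboolP => // -[_ ?]; rewrite asboolT.
- move=> k b; have := card_right_ge zs t (flips f) pi k b.
  rewrite -(ler_nat R) natrD -addn1 !natrD => h.
  have := cluster_ge (addb pi b); have := gd2 k.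
  have e1 : n%:R / (2 * beta) = n%:R / 2 * beta^-1 :> R.
    by field; rewrite gt_eqF.
  rewrite e1 => h2 h3.
  have : c * (n%:R / 2) <= (beta^-1 - 2 * delta - 2 * eta - 2 / n%:R) * (n%:R / 2).
    by rewrite ler_wpM2r// divr_ge0.
  have -> : (beta^-1 - 2 * delta - 2 * eta - 2 / n%:R) * (n%:R / 2) =
     n%:R / 2 * beta^-1 - n%:R * delta - n%:R * eta - 1.
    by field; rewrite !gt_eqF.
  lra.
- move=> k; have := card_wrong_le zs t (flips f) pi k.
  rewrite -(ler_nat R) natrD => h; have := gd2 k => h2.
  apply: (@le_trans _ _ ((n%:R * delta + n%:R * eta) * (8 * C))).
    rewrite ler_wpM2r ?mulr_ge0 ?(ltW C0)//; lra.
  by rewrite le_eqVlt; apply/orP; left; apply/eqP; rewrite /mismatch_loss; field.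
Qed.


Lemma mismatch_loss_ge0 : 0 <= kap.
Proof. by rewrite !mulr_ge0 ?addr_ge0 ?flip_level_ge0// ltW// C_gt0. Qed.

Variables (e0 c' : R) (K : nat).
Hypothesis e01 : 0 < e0 <= 1.
Hypothesis K0 : (0 < K)%N.
Hypothesis ck0 : 0 < c - kap.
Hypothesis c'_le : c' <= (c - kap) * (1 - e0 - K%:R^-1).
Hypothesis J_gt0 : 0 < J.

Definition layer_entropy : R := ln L%:R + L%:R * expR (- (c' * J)).
Local Notation V := layer_entropy.
Local Notation Im := (Imin n rho p q l).
Local Notation Jm := (calJ n rho p q [set l]).
Local Notation M := (Mell n rho p q l).

Let L0 : 0 < L%:R :> R. Proof. by rewrite ltr0n; case: (L) l => // -[]. Qed.
Let L1 : 1 <= L%:R :> R. Proof. by rewrite ler1n; case: (L) l => // -[]. Qed.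

Lemma layer_entropy_ge0 : 0 <= V.
Proof. by rewrite addr_ge0 ?ln_ge0// mulr_ge0 ?expR_ge0. Qed.

(** The mismatch cost is at most [kap] times the rate itself and lowers [c] to c - [kap]. The factor
    3 to the number of strong layers is at most exp(2 Im/(e0 J)), and the other factors are absorbed
    by the layer entropy. *)
Lemma node_error_rate i :
  bern_expect mu (fun w => (`[< good_node i w /\ node_error i w >])%:R) <=
  expR (1 - (c - kap) * Jm) +
  expR (- ((c - kap) * Im) + 2 * Im / (e0 * J) + 3 + (K%:R + 2) * V).
Proof.
have k0 := mismatch_loss_ge0; have [cpos c1] := andP c01; have [e0pos e0le] := andP e01.
have ck01 : 0 < c - kap <= 1 by rewrite ck0; lra.
apply: le_trans (node_error_prob i) _; apply: lerD.
  rewrite addrC [1 - _]addrC [X in _ <= X]expRD mulrC; apply: ler_pM; rewrite ?expR_ge0//.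
    have := half_info_le_calJ n rho_bd p01 q01 l.
    by move=> /(ler_wpM2l k0) h; rewrite ler_expR; lra.
  by have := @expR_ge1Dx R 1; lra.
apply: (@le_trans _ _ (\sum_(tau : {ffun 'I_L -> option bool} | tau l == None)
  expR (- ((c - kap) * calI n rho p q (kept tau))))).
  apply: ler_sum => tau _.
  have := dsum_le_calI n rho_bd p01 q01 (kept tau).
  by move=> /(ler_wpM2l k0) h; rewrite ler_expR; lra.
have h := sum_expR_calI n l rho_bd p01 q01 ck01 K0 c'_le.
apply: le_trans h _.
have -> : - ((c - kap) * Im) + 2 * Im / (e0 * J) + 3 + (K%:R + 2) * V =
  - ((c - kap) * Im) + (2 * Im / (e0 * J) + (3 + (K%:R + 2) * V)) by ring.
rewrite [X in _ <= X]expRD ler_wpM2l ?expR_ge0// [X in _ <= X]expRD.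
apply: ler_pM; rewrite ?exprn_ge0 ?addr_ge0 ?mulr_ge0 ?exprn_ge0 ?expR_ge0//.
  apply: (@le_trans _ _ (expR (2 * #|strong_layers n rho p q l e0|%:R))).
    rewrite expRM_natr; apply: lerXn2r; rewrite ?nnegrE ?expR_ge0//.
    by have := @expR_ge1Dx R 2; lra.
  rewrite ler_expR ler_pdivlMr ?mulr_gt0// -mulrA ler_wpM2l//.
  exact: card_strong_le.
have lnL : 0 <= ln L%:R :> R by rewrite ln_ge0.
have Le0 : 0 <= L%:R * expR (- (c' * J)) by rewrite mulr_ge0 ?expR_ge0.
have KR : 0 <= K%:R :> R by [].
have LK : L%:R ^+ K = expR (ln L%:R * K%:R) :> R by rewrite expRM_natr lnK.
have h1 : expR 2 * L%:R ^+ K <= expR (2 + (K%:R + 2) * V).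
  rewrite LK -expRD ler_expR lerD2l /layer_entropy.
  have : 0 <= K%:R * (L%:R * expR (- (c' * J))) by rewrite mulr_ge0.
  lra.
have h2 : expR (2 * expR (- (c' * J)) * L%:R) <= expR (2 + (K%:R + 2) * V).
  rewrite ler_expR /layer_entropy.
  have : 0 <= K%:R * (L%:R * expR (- (c' * J))) by rewrite mulr_ge0.
  have : 0 <= K%:R * ln L%:R :> R by rewrite mulr_ge0.
  lra.
apply: le_trans (lerD h1 h2) _.
have -> : 3 + (K%:R + 2) * V = 1 + (2 + (K%:R + 2) * V) by ring.
rewrite [X in _ <= X]expRD; have := @expR_ge1Dx R 1.
have := expR_ge0 (2 + (K%:R + 2) * V); set x := expR (2 + _) => x0 h3.
have : 2 * x <= expR 1 * x by rewrite ler_wpM2r//; lra.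
lra.
Qed.

Variable D : R.
Hypothesis M_gt0 : 0 < M.
Hypothesis D_ge : 1 - (c - kap) + 2 / (e0 * J) +
  ((K%:R + 2) * V + Num.sqrt M + 3) / M <= D.

Local Notation bound := (expR (- ((1 - D) * Im)) + expR (- ((1 - D) * Jm))).

(** All lower-order terms are at most a multiple of M and go into [D]. The summand sqrt M in [D]
    leaves the spare factor e^{-sqrt M} needed for Markov's inequality. *)
Lemma node_error_rate_bound i :
  bern_expect mu (fun w => (`[< good_node i w /\ node_error i w >])%:R) <=
  expR (- Num.sqrt M) * bound.
Proof.
have [e0pos e0le] := andP e01; have V0 := layer_entropy_ge0.
have MI : M <= Im by rewrite /Mell ge_min lexx.
have MJ : M <= Jm by rewrite /Mell ge_min lexx orbT.
have sM := sqrtr_ge0 M; have KR : 0 <= K%:R :> R by [].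
have KV : 0 <= (K%:R + 2) * V by rewrite mulr_ge0// addr_ge0.
apply: le_trans (node_error_rate i) _; rewrite [X in _ <= X]mulrDr -!expRD addrC.
pose W := ((K%:R + 2) * V + Num.sqrt M + 3) / M.
have W0 : 0 <= W by rewrite /W divr_ge0 ?addr_ge0// ltW.
have WM : W * M = (K%:R + 2) * V + Num.sqrt M + 3 by rewrite /W divfK// gt_eqF.
have eJ : 0 <= (e0 * J)^-1 by rewrite invr_ge0 mulr_ge0// ltW.
apply: lerD; rewrite ler_expR.
  have h1 : W * M <= W * Im by rewrite ler_wpM2l.
  have h2 : (1 - (c - kap) + 2 / (e0 * J) + W) * Im <= D * Im.
    by rewrite ler_wpM2r//; apply: le_trans MI; rewrite ltW.
  lra.
have h1 : W * M <= W * Jm by rewrite ler_wpM2l.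
have Jm0 : 0 <= Jm by apply: le_trans MJ; rewrite ltW.
have h2 : (1 - (c - kap) + 2 / (e0 * J) + W) * Jm <= D * Jm by rewrite ler_wpM2r.
have h3 : 0 <= 2 * (e0 * J)^-1 * Jm by rewrite !mulr_ge0.
lra.
Qed.

Hypothesis clusters_large : 4 * (delta + n%:R^-1) < (2 * beta)^-1.

(** When the claim fails, some initialization is bad ([F1] >= 1), some layer has too many flips
    ([F2] >= 1), or the good nodes carry too many errors ([F3] >= 1). Taking expectations gives the
    three error terms. *)
Lemma loss_probability_ge :
  1 - (\sum_i Pr rho p q zs (fun o => n%:R * delta < (dH_init (tz Init o.2 i) zs)%:R) +
       L%:R * expR (- n%:R) + expR (- Num.sqrt M)) <=
  Pr rho p q zs (fun o => forall zhat : 'I_n -> bool,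
    alg3_out rho p q Init o.2 l zhat -> loss zhat (zind zs o.1 l) <= bound).
Proof.
set claim := (fun o : Omega n L => _).
have bd0 : 0 < bound by rewrite addr_gt0 ?expR_gt0.
pose F1 (w : {ffun model_coord n L -> bool}) : R := \sum_i (`[< n%:R * delta < (dH_init (tz Init (adjacency zs w) i) zs)%:R >])%:R.
pose F2 (w : {ffun model_coord n L -> bool}) : R := \sum_(k : 'I_L) (n%:R * eta < #|[set j | flips w (k, j)]|%:R)%R%:R.
pose F3 (w : {ffun model_coord n L -> bool}) : R := (n%:R * bound)^-1 *
  \sum_i (`[< good_node i w /\ node_error i w >])%:R.
have nb0 : 0 < n%:R * bound by rewrite mulr_gt0.
have F10 w : 0 <= F1 w by apply: sumr_ge0.
have F20 w : 0 <= F2 w by apply: sumr_ge0.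
have F30 w : 0 <= F3 w by rewrite mulr_ge0 ?invr_ge0 ?(ltW nb0)// sumr_ge0.
have key w : 1 <= (`[< claim (outcome zs w) >])%:R + (F1 w + F2 w + F3 w).
  case: asboolP => [_|nclaim]; first by rewrite lerDl !addr_ge0.
  rewrite add0r.
  have [[i hi]|ninit] := pselect (exists i, n%:R * delta < (dH_init (tz Init (adjacency zs w) i) zs)%:R).
    have h : 1 <= F1 w by rewrite /F1 (bigD1 i)//= asboolT//= lerDl sumr_ge0.
    by have := F20 w; have := F30 w; lra.
  have [[k hk]|nflip] := pselect (exists k, n%:R * eta < #|[set j | flips w (k, j)]|%:R).
    have h : 1 <= F2 w by rewrite /F2 (bigD1 k)//= hk /= lerDl sumr_ge0.
    by have := F10 w; have := F30 w; lra.
  have init_ok i : (dH_init (tz Init (adjacency zs w) i) zs)%:R <= n%:R * delta.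
    by rewrite leNgt; apply/negP => h; apply: ninit; exists i.
  have good i : good_node i w.
    split=> // k; apply: (@le_trans _ _ #|[set j | flips w (k, j)]|%:R).
      by rewrite ler_nat; exact: card_Vtx_le.
    by rewrite leNgt; apply/negP => h; apply: nflip; exists k.
  suff : 1 <= F3 w by have := F10 w; have := F20 w; lra.
  move: nclaim => /existsNP[zhat] /not_implyP[hout /negP]; rewrite -ltNge => hloss.
  pose e := Num.truncn (n%:R * delta).
  have nd0 : 0 <= n%:R * delta by rewrite mulr_ge0.
  have he i : (dH_init (tz Init (adjacency zs w) i) zs <= e)%N.
    by rewrite /e truncn_ge_nat.
  have hcl b : (4 * e.+1 < #|[set i | zs i == b]|)%N.
    rewrite -(ltr_nat R) natrM -addn1 natrD; apply: lt_le_trans (cluster_ge b).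
    have : e%:R <= n%:R * delta by rewrite /e truncn_le.
    have : n%:R * (4 * (delta + n%:R^-1)) < n%:R * (2 * beta)^-1 by rewrite ltr_pM2l.
    have -> : n%:R * (4 * (delta + n%:R^-1)) = 4 * (n%:R * delta) + 4.
      by field; rewrite gt_eqF.
    lra.
  have := @loss_le_row_errors R n L rho p q Init zs (flips w) (adjacency zs w) l e he hcl
    zhat n0 hout.
  move=> /(lt_le_trans hloss); rewrite ltr_pdivlMr// mulrC => h.
  rewrite /F3 mulrC ler_pdivlMr// mul1r; apply: le_trans (ltW h) _.
  apply: ler_sum => i _; rewrite ler_nat.
  by case: asboolP => // he2; rewrite asboolT//; split.
have : 1 <= bern_expect mu (fun w => (`[< claim (outcome zs w) >])%:R + (F1 w + F2 w + F3 w)).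
  by rewrite -[X in X <= _](bern_expect_cst mu 1); apply: le_bern_expect.
rewrite !bern_expectD -Pr_expect.
have e1 : bern_expect mu F1 = \sum_i Pr rho p q zs
    (fun o => n%:R * delta < (dH_init (tz Init o.2 i) zs)%:R).
  by rewrite /F1 bern_expect_sum; apply: eq_bigr => i _; rewrite Pr_expect.
have e2 : bern_expect mu F2 <= L%:R * expR (- n%:R).
  rewrite /F2 bern_expect_sum; apply: (@le_trans _ _ (\sum_(k < L) expR (- n%:R))).
    by apply: ler_sum => k _; exact: flip_tail.
  by rewrite sumr_const card_ord mulr_natl.
have e3 : bern_expect mu F3 <= expR (- Num.sqrt M).
  rewrite /F3 bern_expectZ bern_expect_sum mulrC ler_pdivrMr//.
  apply: (@le_trans _ _ (\sum_(i < n) expR (- Num.sqrt M) * bound)).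
    by apply: ler_sum => i _; exact: node_error_rate_bound.
  by rewrite sumr_const card_ord -mulr_natl le_eqVlt; apply/orP; left; apply/eqP; ring.
lra.
Qed.

End FiniteSample.

(** * Asymptotics *)

Local Open Scope classical_set_scope.

Section Limits.
Variable R : realType.
Implicit Types u rho : nat -> R.

Lemma near_natr_ge (A : R) : \forall n \near \oo, A <= n%:R.
Proof. by have /cvgryPge := @cvgr_idn R; apply. Qed.

Lemma cvg_div_dvg u (c : R) : 0 <= c -> (forall A, \forall n \near \oo, A <= u n) ->
  (fun n => c / u n) @ \oo --> (0 : R).
Proof.
move=> c0 hu; apply/cvgr0Pnorm_le => e e0; near=> n.
have h1 : 1 <= u n by near: n; exact: hu.
have h2 : c / e <= u n by near: n; exact: hu.
have un0 : 0 < u n by lra.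
rewrite ger0_norm; last by rewrite divr_ge0// ltW.
by rewrite ler_pdivrMr// -ler_pdivrMl// mulrC.
Unshelve. all: by end_near. Qed.

Lemma near_ln_ge rho (A : R) : (forall n, 0 < rho n) -> rho @ \oo --> (0 : R) ->
  \forall n \near \oo, A <= - ln (rho n).
Proof.
move=> r0 rc; near=> n.
have h : `|rho n| <= expR (- A).
  by near: n; move/cvgr0Pnorm_le: rc; apply; exact: expR_gt0.
rewrite lerNr -(@expRK R (- A)) ler_ln ?posrE ?expR_gt0//.
exact: le_trans (ler_norm _) h.
Unshelve. all: by end_near. Qed.

Lemma near_Jrho_ge rho (A : R) : (forall n, 0 < rho n < 1 / 2) ->
  rho @ \oo --> (0 : R) -> \forall n \near \oo, A <= Jrho (rho n).
Proof.
move=> rb rc; near=> n.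
have [r0 r2] := rho_bds (rb n).
have h : `|rho n| <= expR (- (2 * A)) / 4.
  by near: n; move/cvgr0Pnorm_le: rc; apply; rewrite divr_gt0// expR_gt0.
have h2 := le_trans (ler_norm _) h.
have : expR (- (2 * Jrho (rho n))) <= expR (- (2 * A)).
  rewrite expR_Jrho//; have := sqr_ge0 (rho n); rewrite expr2; lra.
by rewrite ler_expR; lra.
Unshelve. all: by end_near. Qed.

(** From ln x < x at x = sqrt n one gets ln n <= 2 sqrt n, so c ln n <= n/2 once sqrt n >= 4c. *)
Lemma near_powR_expR_le (c e : R) : 0 < c -> 0 < e ->
  \forall n \near \oo, n%:R `^ c * expR (- n%:R) <= e.
Proof.
move=> c0 e0; near=> n.
have n1 : 1 <= n%:R :> R by near: n; exact: near_natr_ge.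
have n2 : (4 * c) ^+ 2 <= n%:R by near: n; exact: near_natr_ge.
have n3 : 2 / e <= n%:R by near: n; exact: near_natr_ge.
have n0 : 0 < n%:R :> R by lra.
set x := Num.sqrt (n%:R : R).
have x0 : 0 < x by rewrite sqrtr_gt0.
have xx : x * x = n%:R by rewrite -expr2 sqr_sqrtr// ltW.
have x4 : 4 * c <= x.
  by rewrite -[4 * c]ger0_norm -?sqrtr_sqr ?ler_wsqrtr// mulr_ge0// ltW.
have hl : ln (n%:R : R) <= 2 * x.
  rewrite -xx lnM ?posrE//; have := ln_sublinear x0; lra.
rewrite /powR gt_eqF// -expRD.
apply: (@le_trans _ _ (expR (- (n%:R / 2)))).
  rewrite ler_expR.
  have : c * ln n%:R <= c * (2 * x) by rewrite ler_wpM2l// ltW.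
  have : 4 * c * x <= x * x by rewrite ler_wpM2r// ltW.
  lra.
rewrite expRN -[e]invrK lef_pV2 ?posrE ?invr_gt0 ?expR_gt0//.
apply: le_trans (expR_ge1Dx _).
have : 2 / e / 2 <= n%:R / 2 by rewrite ler_wpM2r// invr_ge0.
have -> : 2 / e / 2 = e^-1 by field; rewrite gt_eqF.
lra.
Unshelve. all: by end_near. Qed.

Lemma near_natr_powR_le (C eps e : R) : 0 < C -> 0 < eps -> 0 < e ->
  \forall n \near \oo, n%:R * (C * n%:R `^ (- (1 + eps))) <= e.
Proof.
move=> C0 eps0 e0; near=> n.
have n1 : 1 <= n%:R :> R by near: n; exact: near_natr_ge.
have n2 : expR (- ln (e / C) / eps) <= n%:R by near: n; exact: near_natr_ge.
have n0 : 0 < n%:R :> R by lra.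
have e1 : n%:R * n%:R `^ (- (1 + eps)) = expR (- eps * ln n%:R) :> R.
  rewrite /powR gt_eqF// -{1}[n%:R](@lnK R) ?posrE// -expRD.
  by congr expR; ring.
rewrite mulrCA e1 mulrC -ler_pdivlMr//.
rewrite -[X in _ <= X](@lnK R) ?posrE ?divr_gt0// ler_expR.
have : - ln (e / C) / eps <= ln n%:R.
  by rewrite -(@expRK R (- ln (e / C) / eps)) ler_ln ?posrE ?expR_gt0.
rewrite ler_pdivrMr//; lra.
Unshelve. all: by end_near. Qed.

Lemma near_expR_sqrt_le u (e : R) : 0 < e -> (forall A, \forall n \near \oo, A <= u n) ->
  \forall n \near \oo, expR (- Num.sqrt (u n)) <= e.
Proof.
move=> e0 hu; near=> n.
have h : (e^-1) ^+ 2 <= u n by near: n; exact: hu.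
rewrite expRN -[e]invrK lef_pV2 ?posrE ?invr_gt0 ?expR_gt0//.
apply: le_trans (expR_ge1Dx _).
have : e^-1 <= Num.sqrt (u n).
  by rewrite -[e^-1]ger0_norm ?invr_ge0 ?(ltW e0)// -sqrtr_sqr ler_wsqrtr.
lra.
Unshelve. all: by end_near. Qed.

Lemma cvg_sqrt_div u : (forall A, \forall n \near \oo, A <= u n) ->
  (fun n => Num.sqrt (u n) / u n) @ \oo --> (0 : R).
Proof.
move=> hu; have hs A : \forall n \near \oo, A <= Num.sqrt (u n).
  near=> n; have h : A ^+ 2 <= u n by near: n; exact: hu.
  by apply: le_trans (ler_norm A) _; rewrite -sqrtr_sqr ler_wsqrtr.
have := cvg_div_dvg ler01 hs; apply: cvg_trans; apply: near_eq_cvg; near=> n.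
have h1 : 1 <= u n by near: n; exact: hu.
have u0 : 0 < u n by lra.
have s0 : 0 < Num.sqrt (u n) by rewrite sqrtr_gt0.
have us : u n = Num.sqrt (u n) * Num.sqrt (u n) by rewrite -expr2 sqr_sqrtr// ltW.
by move: us s0; set s := Num.sqrt _ => -> s0; field; rewrite gt_eqF.
Unshelve. all: by end_near. Qed.

End Limits.

Lemma le_Pr (R : realType) (n L : nat) (rho : R) (p q : 'I_L -> R) (zs : 'I_n -> bool)
  (E F : Omega n L -> Prop) : (forall c, 0 <= coord_mean (n := n) rho p q c <= 1) ->
  (forall o, E o -> F o) -> Pr rho p q zs E <= Pr rho p q zs F.
Proof.
move=> mu01 EF; rewrite !Pr_expect; apply: le_bern_expect => // w.
by rewrite ler_nat; case: asboolP => // /EF h; rewrite asboolT.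
Qed.

Theorem mainTheorem18 (R : realType)
  (L : nat -> nat) (rho : nat -> R) (p q : forall n, 'I_(L n) -> R)
  (beta : nat -> R) (Init : forall n, InitT n (L n))
  (l0 : nat) (ell : forall n, 'I_(L n)) (c' : R) :
  (* rho in (0, 1/2), rho = o(1) *)
  (forall n, 0 < rho n < 1 / 2) ->
  rho @ \oo --> (0 : R) ->
  (* p_l asymp q_l = o(1) *)
  (exists C : R, forall n (k : 'I_(L n)),
      0 < q n k /\ q n k < p n k /\ p n k < 1 /\ p n k <= C * q n k) ->
  (forall e : R, 0 < e -> \forall n \near \oo, forall k : 'I_(L n), p n k <= e) ->
  (* beta = 1 + o(1) *)
  beta @ \oo --> (1 : R) ->
  (* L <= n^c *)
  (exists c : R, 0 < c /\ \forall n \near \oo, (L n)%:R <= n%:R `^ c) ->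
  (* consistent-initialization assumption *)
  (exists (delta : nat -> R) (eps C' : R),
      delta @ \oo --> (0 : R) /\ 0 < eps /\ 0 < C' /\
      forall n (zs : 'I_n -> bool), balanced (beta n) zs ->
      forall i : 'I_n,
        Pr (rho n) (p n) (q n) zs
           (fun w => n%:R * delta n < (dH_init (tz (Init n) w.2 i) zs)%:R)
        <= C' * n%:R `^ (- (1 + eps))) ->
  (* the fixed layer l *)
  (forall n, val (ell n) = l0) ->
  0 < c' < 1 ->
  (fun n => (ln (L n)%:R + (L n)%:R * expR (- (c' * Jrho (rho n))))
            / Mell n (rho n) (p n) (q n) (ell n)) @ \oo --> (0 : R) ->
  (fun n => Mell n (rho n) (p n) (q n) (ell n)) @ \oo --> +oo ->
  exists dbar : nat -> R,
    dbar @ \oo --> (0 : R) /\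
    forall e : R, 0 < e ->
      \forall n \near \oo, forall zs : 'I_n -> bool, balanced (beta n) zs ->
        1 - e <=
        Pr (rho n) (p n) (q n) zs
          (fun w => forall zhat : 'I_n -> bool,
             alg3_out (rho n) (p n) (q n) (Init n) w.2 (ell n) zhat ->
             loss zhat (zind zs w.1 (ell n)) <=
               expR (- ((1 - dbar n) * Imin n (rho n) (p n) (q n) (ell n)))
             + expR (- ((1 - dbar n) * calJ n (rho n) (p n) (q n) [set ell n]))).
Proof.
move=> rho_bd rho0 [C hC] psmall beta1 [cL [cL0 hL]] [delta [eps [C' [delta0 [eps0 [C'0 hinit]]]]]].
move=> _ /andP[c'0 c'1] entropy0 Minf.
have rpos n : 0 < rho n by have [] := rho_bds (rho_bd n).
pose J n := Jrho (rho n).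
pose M n := Mell n (rho n) (p n) (q n) (ell n).
pose V n := layer_entropy (L n) (rho n) c'.
(* The finite-sample bound asks for a nonnegative radius; enlarging the radius only shrinks the
   failure event of the initialization. *)
pose dl n := `|delta n|.
pose eta n := flip_level (rho n).
(* With x = 1 - c', e0 and 1/K are at most x/4, and later c - [kap] >= 1 - x/8; then (1 - x/8)(1 -
   x/2) >= 1 - x = c', as the partition sum requires. *)
pose e0 : R := (1 - c') / 4.
pose K := (Num.truncn (4 / (1 - c'))).+1.
have c'e : 0 < 1 - c' by lra.
have e01 : 0 < e0 <= 1 by rewrite /e0; lra.
have [e0pos e0le] := andP e01.
have Kinv : K%:R^-1 <= (1 - c') / 4 :> R.
  rewrite -[(1 - c') / 4]invf_div lef_pV2 ?posrE ?ltr0n ?divr_gt0//.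
  exact/ltW/truncnS_gt.
have Mge A : \forall n \near \oo, A <= M n by move/cvgryPge: Minf; apply.
have Jge A : \forall n \near \oo, A <= J n by exact: (near_Jrho_ge A rho_bd rho0).
have dl0 : dl @ \oo --> (0 : R) by rewrite -(normr0 R); apply: cvg_norm.
have eta0 : eta @ \oo --> (0 : R).
  by apply: cvg_div_dvg => // A; exact: (near_ln_ge A rpos rho0).
have n_inv : (fun n => 2 / n%:R) @ \oo --> (0 : R).
  by apply: cvg_div_dvg => // A; exact: near_natr_ge.
have beta_inv : (fun n => `|1 - (beta n)^-1|) @ \oo --> (0 : R).
  have -> : (0 : R) = `|1 - 1^-1| by rewrite invr1 subrr normr0.
  by apply: cvg_norm; apply: cvgB; [exact: cvg_cst | exact: cvgV].
pose defect n := `|1 - (beta n)^-1| + 2 * dl n + 2 * eta n + 2 / n%:R.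
have defect0 : defect @ \oo --> (0 : R).
  have -> : (0 : R) = 0 + 2 * 0 + 2 * 0 + 0 by rewrite !mulr0 !addr0.
  by do ![apply: cvgD => //]; apply: cvgMl_tmp.
pose kap n := 16 * C * (dl n + eta n).
have kap0 : kap @ \oo --> (0 : R).
  have -> : (0 : R) = 16 * C * (0 + 0) by rewrite addr0 mulr0.
  by apply: cvgMl_tmp; apply: cvgD.
(* The slack of the finite-sample bound for c = 1 - [defect n], written as a sum of null
   sequences. *)
pose dbar n := defect n + kap n + 2 / e0 / J n +
  ((K%:R + 2) * (V n / M n) + Num.sqrt (M n) / M n + 3 / M n).
exists dbar; split.
  have -> : (0 : R) = 0 + 0 + 0 + ((K%:R + 2) * 0 + 0 + 0) by rewrite mulr0 !addr0.
  apply: cvgD.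
    apply: cvgD; first exact: cvgD.
    by apply: cvg_div_dvg => //; rewrite divr_ge0// ltW.
  apply: cvgD; last exact: cvg_div_dvg.
  apply: cvgD; last exact: cvg_sqrt_div.
  by apply: cvgMl_tmp; exact: entropy0.
move=> e e_gt0.
have e3 : 0 < e / 3 by rewrite divr_gt0.
(* The index is chosen before the labels, which gives uniformity over balanced label vectors. *)
near=> n => zs bal.
have n1 : 1 <= n%:R :> R by near: n; exact: near_natr_ge.
have n0 : (0 < n)%N by rewrite -(ltr_nat R); clear -n1; lra.
have nR : 0 < n%:R :> R by rewrite ltr0n.
have p2 k : p n k <= 2^-1.
  by move: k; near: n; apply: psmall; rewrite invr_gt0.
have q0 k : 0 < q n k by have [] := hC n k.
have qp k : q n k < p n k by have [_ []] := hC n k.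
have pC k : p n k <= C * q n k by have [_ [_ []]] := hC n k.
have M1 : 1 <= M n by near: n; exact: Mge.
have J1 : 1 <= J n by near: n; exact: Jge.
have small_defect : `|defect n| <= (1 - c') / 16.
  by near: n; move/cvgr0Pnorm_le: defect0; apply; rewrite divr_gt0.
have small_kap : `|kap n| <= (1 - c') / 16.
  by near: n; move/cvgr0Pnorm_le: kap0; apply; rewrite divr_gt0.
have small_dl : `|dl n| <= 1 / 32.
  by near: n; move/cvgr0Pnorm_le: dl0; apply; rewrite divr_gt0.
have n64 : 64 <= n%:R :> R by near: n; exact: near_natr_ge.
have dn0 : 0 <= dl n by exact: normr_ge0.
have et0 : 0 <= eta n by exact: flip_level_ge0.
have ni0 : 0 <= 2 / n%:R :> R by rewrite divr_ge0// ltW.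
have hd := le_trans (ler_norm _) small_defect.
have hk := le_trans (ler_norm _) small_kap.
have hb0 := normr_ge0 (1 - (beta n)^-1).
have hb1 : `|1 - (beta n)^-1| <= 1 / 16.
  by move: hd; rewrite /defect; clear -dn0 et0 ni0 c'0; lra.
have [hb2 hb3] : - (1 / 16) <= 1 - (beta n)^-1 /\ 1 - (beta n)^-1 <= 1 / 16.
  by move: hb1; rewrite ler_norml => /andP.
have beta_pos : 0 < beta n by rewrite -invr_gt0; clear -hb3; lra.
have c01 : 0 < 1 - defect n <= 1.
  apply/andP; split; first by clear -hd c'0; lra.
  by rewrite lerBlDr lerDl /defect !addr_ge0// mulr_ge0.
have c_le : 1 - defect n <= (beta n)^-1 - 2 * dl n - 2 * eta n - 2 / n%:R.
  by rewrite /defect; have := ler_norm (1 - (beta n)^-1); clear; lra.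
have ck0 : 0 < 1 - defect n - kap n by clear -hd hk c'0; lra.
have kap_n0 : 0 <= kap n.
  exact: (mismatch_loss_ge0 (rho_bd n) q0 qp pC (ell n) dn0).
have c'_le : c' <= (1 - defect n - kap n) * (1 - e0 - K%:R^-1).
  apply: (@le_trans _ _ ((1 - (1 - c') / 8) * (1 - (1 - c') / 2))).
    have : 0 <= (1 - c') * (1 - c') by rewrite mulr_ge0// ltW.
    by clear -c'e; lra.
  apply: ler_pM; [by clear -c'0; lra | by clear -c'0; lra | by clear -hd hk; lra |].
  by move: Kinv; rewrite /e0; clear; lra.
(* The left side is at most 4(1/32 + 1/64) = 3/16, the right side at least 15/32. *)
have clusters : 4 * (dl n + n%:R^-1) < (2 * beta n)^-1.
  rewrite invfM; have := le_trans (ler_norm _) small_dl.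
  have : n%:R^-1 <= 64^-1 :> R by rewrite lef_pV2 ?posrE//.
  by clear -hb3; lra.
have M0 : 0 < M n by exact: lt_le_trans M1.
have J0 : 0 < J n by exact: lt_le_trans J1.
have D_ge : 1 - (1 - defect n - kap n) + 2 / (e0 * J n) +
  ((K%:R + 2) * V n + Num.sqrt (M n) + 3) / M n <= dbar n.
  rewrite le_eqVlt; apply/orP; left; apply/eqP; rewrite /dbar.
  move: e0pos J0 M0; clear; move: (J n) (M n) => x y e0pos x0 y0.
  by field; rewrite !gt_eqF.
have main := @loss_probability_ge R n (L n) (rho n) (p n) (q n) C (beta n) (dl n) n0
  (rho_bd n) q0 qp p2 pC (Init n) zs (ell n) beta_pos bal dn0 (1 - defect n) c01 c_le
  e0 c' K e01 isT ck0 c'_le J0 (dbar n) M0 D_ge clusters.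
apply: le_trans main; rewrite lerD2l lerN2.
have h1 : \sum_i Pr (rho n) (p n) (q n) zs (fun o => n%:R * dl n <
    (dH_init (tz (Init n) o.2 i) zs)%:R) <= e / 3.
  apply: (@le_trans _ _ (\sum_(i < n) C' * n%:R `^ (- (1 + eps)))).
    apply: ler_sum => i _; apply: le_trans (hinit n zs bal i).
    apply: le_Pr => [x|o h].
      exact: (coord_mean_bd (rho_bd n) q0 qp p2).
    by apply: le_lt_trans h; rewrite ler_wpM2l ?(ltW nR)// ler_norm.
  rewrite sumr_const card_ord -[X in X <= _]mulr_natl.
  by near: n; exact: near_natr_powR_le.
have h2 : (L n)%:R * expR (- n%:R) <= e / 3 :> R.
  apply: (@le_trans _ _ (n%:R `^ cL * expR (- n%:R))).
    by rewrite ler_wpM2r ?expR_ge0//; near: n; exact: hL.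
  by near: n; exact: near_powR_expR_le.
have h3 : expR (- Num.sqrt (M n)) <= e / 3 by near: n; exact: near_expR_sqrt_le.
by move: h1 h2 h3; rewrite -/(M n); clear; lra.
Unshelve. all: by end_near. Qed.
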